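(* Let $Q$ be the quiver with three vertices $1,2,3$ and three arrows $\alpha\colon 2\to 1$, $\beta\colon 2\to 2$ (a loop), $\gamma\colon 3\to 2$. For every field $k$ there exists an admissible ideal $I\subseteq kQ$ such that the finite dimensional $k$-algebra $\Lambda=kQ/I$ (whose ordinary quiver is $Q$) satisfies $\mathrm{HH}^1(\Lambda)=0$, i.e. every $k$-derivation of $\Lambda$ is inner. Moreover, every algebra $\Lambda=kQ/I$ with $I$ admissible has infinite global dimension, and every such $\Lambda$ with $\mathrm{HH}^1(\Lambda)=0$ is of infinite representation type.
   Context: The path algebra $kQ$ is the $k$-algebra generated by pairwise orthogonal idempotents $e_1,e_2,e_3$ with $e_1+e_2+e_3=1$ and by $\alpha,\beta,\gamma$, subject to $e_1\alpha=\alpha=\alpha e_2$, $e_2\beta=\beta=\beta e_2$, $e_3\gamma=\gamma=\gamma e_2$, $\gamma\alpha=\beta\alpha=\gamma\beta=0$ (so products such as $\alpha\beta^i\gamma$ are nonzero paths). An ideal $I\subseteq kQ$ is admissible if $(\alpha,\beta,\gamma)^N\subseteq I\subseteq(\alpha,\beta,\gamma)^2$ for some $N\ge 2$. For a $k$-algebra $\Lambda$, $\mathrm{HH}^1(\Lambda)=\mathrm{Der}_k(\Lambda,\Lambda)/\mathrm{Inn}(\Lambda)$ is the space of $k$-derivations modulo inner derivations. *)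

(* Defs.v *)
From HB Require Import structures.
From mathcomp Require Import all_boot all_order all_algebra.
Set Implicit Arguments. Unset Strict Implicit. Unset Printing Implicit Defensive.
Import GRing.Theory.
Local Open Scope ring_scope.

(* The path algebra kQ of the quiver  1 <-alpha- 2 (loop beta) <-gamma- 3,   *)
(* realised (faithfully) inside the ring of 3x3 matrices over k[X]:          *)
(* vertex i is the matrix unit E_ii, alpha = E_12, beta = X E_22,            *)
(* gamma = E_23 (indices 0,1,2 of 'I_3 stand for vertices 1,2,3).           *)
(* Entry (i,j) of an element records the paths from j to i, so matrix       *)
(* multiplication is concatenation of paths, written like composition       *)
(* (e_1 alpha = alpha = alpha e_2, etc.).  kQ is defined literally as the    *)
(* k-subalgebra generated by e_1,e_2,e_3,alpha,beta,gamma.                  *)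

Section PathAlgebra.
Variable k : fieldType.

Definition Mx := 'M[{poly k}]_3.

Definition v1 : 'I_3 := @Ordinal 3 0 isT.
Definition v2 : 'I_3 := @Ordinal 3 1 isT.
Definition v3 : 'I_3 := @Ordinal 3 2 isT.

Definition idem (i : 'I_3) : Mx := delta_mx i i.
Definition alpha : Mx := delta_mx v1 v2.
Definition beta : Mx := 'X *: delta_mx v2 v2.
Definition gamma : Mx := delta_mx v2 v3.

Definition arrow (a : 'I_3) : Mx :=
  if val a == 0%N then alpha else if val a == 1%N then beta else gamma.

Inductive kQ : Mx -> Prop :=
| kQ_idem i : kQ (idem i)
| kQ_arrow a : kQ (arrow a)
| kQ_zero : kQ 0
| kQ_add a b : kQ a -> kQ b -> kQ (a + b)
| kQ_scale (c : k) a : kQ a -> kQ (c%:P *: a)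
| kQ_mul a b : kQ a -> kQ b -> kQ (a * b).

Definition is_ideal (I : Mx -> Prop) : Prop :=
  (forall a, I a -> kQ a) /\ I 0 /\
  (forall a b, I a -> I b -> I (a + b)) /\
  (forall (c : k) a, I a -> I (c%:P *: a)) /\
  (forall a b, kQ a -> I b -> I (a * b) /\ I (b * a)).

Definition gen_ideal (S : Mx -> Prop) (x : Mx) : Prop :=
  forall I, is_ideal I -> (forall s, S s -> I s) -> I x.

Definition arrow_ideal_pow (n : nat) : Mx -> Prop :=
  gen_ideal (fun x => exists w : seq 'I_3,
                 size w = n /\ x = \prod_(a <- w) arrow a).

Definition admissible (I : Mx -> Prop) : Prop :=
  is_ideal I /\
  exists N : nat, (2 <= N)%N /\
    (forall x, arrow_ideal_pow N x -> I x) /\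
    (forall x, I x -> arrow_ideal_pow 2 x).

(* HH^1(kQ/I) = 0.  Elements of Lambda = kQ/I are represented by elements   *)
(* of kQ, equality in Lambda being congruence modulo I.  A map             *)
(* Lambda -> Lambda is represented by any lift D on representatives.        *)

Definition is_derivation (I : Mx -> Prop) (D : Mx -> Mx) : Prop :=
  (forall a, kQ a -> kQ (D a)) /\
  (forall a b, kQ a -> kQ b -> I (a - b) -> I (D a - D b)) /\
  (forall (c : k) a b, kQ a -> kQ b ->
      I (D (c%:P *: a + b) - (c%:P *: D a + D b))) /\
  (forall a b, kQ a -> kQ b -> I (D (a * b) - (D a * b + a * D b))).

Definition is_inner (I : Mx -> Prop) (D : Mx -> Mx) : Prop :=
  exists x, kQ x /\ forall a, kQ a -> I (D a - (x * a - a * x)).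

Definition HH1_vanishes (I : Mx -> Prop) : Prop :=
  forall D, is_derivation I D -> is_inner I D.

(* Finite dimensional left Lambda-modules: k^d (column vectors) with a      *)
(* k-algebra map kQ -> M_d(k) killing I.                                    *)

Record rep := Rep { rdim : nat; ract : Mx -> 'M[k]_rdim }.

Definition is_mod (I : Mx -> Prop) (V : rep) : Prop :=
  (forall a b, kQ a -> kQ b -> ract V (a * b) = ract V a *m ract V b) /\
  ract V 1 = 1%:M /\
  (forall (c : k) a b, kQ a -> kQ b ->
      ract V (c%:P *: a + b) = c *: ract V a + ract V b) /\
  (forall a, I a -> ract V a = 0).

Definition is_hom (V W : rep) (F : 'M[k]_(rdim W, rdim V)) : Prop :=
  forall a, kQ a -> F *m ract V a = ract W a *m F.

Definition iso (V W : rep) : Prop :=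
  exists (F : 'M[k]_(rdim W, rdim V)) (G : 'M[k]_(rdim V, rdim W)),
    is_hom F /\ is_hom G /\ G *m F = 1%:M /\ F *m G = 1%:M.

Definition dsum (V W : rep) : rep :=
  @Rep (rdim V + rdim W) (fun a => block_mx (ract V a) 0 0 (ract W a)).

Definition projective (I : Mx -> Prop) (P : rep) : Prop :=
  forall (X Y : rep) (g : 'M[k]_(rdim Y, rdim X)) (f : 'M[k]_(rdim Y, rdim P)),
    is_mod I X -> is_mod I Y -> is_hom g -> \rank g = rdim Y -> is_hom f ->
    exists h : 'M[k]_(rdim X, rdim P), is_hom h /\ g *m h = f.

Fixpoint pd_le (I : Mx -> Prop) (n : nat) (V : rep) : Prop :=
  match n with
  | 0 => projective I V
  | n'.+1 =>
      exists (P K : rep) (p : 'M[k]_(rdim V, rdim P)) (i : 'M[k]_(rdim P, rdim K)),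
        is_mod I P /\ projective I P /\ is_mod I K /\ pd_le I n' K /\
        is_hom p /\ is_hom i /\
        \rank p = rdim V /\
        \rank i = rdim K /\
        p *m i = 0 /\ (\rank i + \rank p)%N = rdim P   (* im i = ker p *)
  end.

Definition infinite_gldim (I : Mx -> Prop) : Prop :=
  forall n : nat, exists V : rep, is_mod I V /\ ~ pd_le I n V.

Definition indecomposable (I : Mx -> Prop) (V : rep) : Prop :=
  is_mod I V /\ (0 < rdim V)%N /\
  forall V1 V2 : rep, is_mod I V1 -> is_mod I V2 -> iso V (dsum V1 V2) ->
    rdim V1 = 0%N \/ rdim V2 = 0%N.

Definition infinite_rep_type (I : Mx -> Prop) : Prop :=
  exists f : nat -> rep,
    (forall n, indecomposable I (f n)) /\
    (forall m n, m <> n -> ~ iso (f m) (f n)).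

End PathAlgebra.

(* Main.v *)
(** Put [A = k[X]].  An admissible ideal [I] consists, at the entries (2,2), (1,2) and (2,3), of the
multiples of [X^n], [X^a] and [X^b] with [n >= 2] and [1 <= a, b <= n]; its entry (1,3) is an
arbitrary subspace [W] of [A] containing [X^a A + X^b A].  Modulo inner derivations a derivation of
[kQ/I] acts on the entry (1,3) as [h d/dX + g].

Vanishing of HH^1: for [a = b = n = 8] and [W] spanned by [1], [X], [X^2 + X^5 + X^7] and [X^8 A],
the condition that [h d/dX + g] preserve [W] is a linear system with integer coefficients, of full rank in
every characteristic, which forces [h = 0] modulo [X^8] and [g] constant modulo [X^8].

Infinite global dimension: the class of [dim e_2 V - b dim e_3 V] modulo [n] is additive on short
exact sequences, vanishes on projectives (it is [n] times the multiplicity of [Lambda e_2]), and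
equals 1 on the simple module at vertex 2.

Infinite representation type: [HH^1 = 0] forces [a = b = n] (else [X^(n-1) d/dX] is outer) and
[n >= 4] (for [n <= 3] some nonzero [h d/dX + g] preserves [W]).  For [n >= 4] the modules with
[k[X]/X^4 (x) k^m] at vertex 2, [k^m + k^m] at vertex 3 and
[gamma (e, f) = 1 (x) e + X (x) f + X^3 (x) J f], with [J] a nilpotent Jordan block, have as
endomorphisms the centraliser of [J], which has no nontrivial idempotent. *)

Require Import Defs.
From mathcomp Require Import all_boot all_order all_algebra.
From mathcomp Require Import ring zify.
From Stdlib Require Import Classical.

Set Implicit Arguments. Unset Strict Implicit. Unset Printing Implicit Defensive.
Import GRing.Theory.
Local Open Scope ring_scope.

(** * Entries, ideals and exponents *)

Section Entries.
Variable k : fieldType.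
Implicit Types (p q : {poly k}) (M N : Mx k) (i j : 'I_3).

Definition unit_mx i j p : Mx k := p *: delta_mx i j.

Lemma ord3P i : [\/ i = v1, i = v2 | i = v3].
Proof.
case: i => [[|[|[|//]]] hi].
- by constructor 1; apply: val_inj.
- by constructor 2; apply: val_inj.
- by constructor 3; apply: val_inj.
Qed.

Lemma sum_ord3 (V : nmodType) (F : 'I_3 -> V) :
  \sum_i F i = F v1 + F v2 + F v3.
Proof.
rewrite !big_ord_recl big_ord0 addr0 addrA.
by congr (F _ + F _ + F _); apply: val_inj.
Qed.

Lemma mulmx3E M N i j :
  (M * N) i j = M i v1 * N v1 j + M i v2 * N v2 j + M i v3 * N v3 j.
Proof. by rewrite mxE sum_ord3. Qed.

Lemma unit_mxE i j p i' j' :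
  unit_mx i j p i' j' = p *+ ((i' == i) && (j' == j)).
Proof. by rewrite !mxE mulr_natr. Qed.

Lemma unit_mxM i j l m p q :
  unit_mx i j p * unit_mx l m q = unit_mx i m (p * q) *+ (j == l).
Proof.
by rewrite /unit_mx -scalerAl -scalerAr scalerA -[delta_mx i j * _]/(_ *m _)
  mul_delta_mx_cond scalerMnr.
Qed.

Lemma unit_mxMM i j l p q :
  unit_mx i j p * unit_mx j l q = unit_mx i l (p * q).
Proof. by rewrite unit_mxM eqxx. Qed.

Lemma unit_mxD i j p q : unit_mx i j (p + q) = unit_mx i j p + unit_mx i j q.
Proof. exact: scalerDl. Qed.

Lemma unit_mxZ i j (c : k) p : unit_mx i j (c *: p) = c%:P *: unit_mx i j p.
Proof. by rewrite /unit_mx scalerA mul_polyC. Qed.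

Lemma unit_mx0 i j : unit_mx i j 0 = 0. Proof. exact: scale0r. Qed.

Lemma idem_unit i : idem k i = unit_mx i i 1. Proof. by rewrite /unit_mx scale1r. Qed.
Lemma alpha_unit : alpha k = unit_mx v1 v2 1. Proof. by rewrite /unit_mx scale1r. Qed.
Lemma beta_unit : beta k = unit_mx v2 v2 'X. Proof. by []. Qed.
Lemma gamma_unit : gamma k = unit_mx v2 v3 1. Proof. by rewrite /unit_mx scale1r. Qed.
Definition kQ_unit := (idem_unit, alpha_unit, beta_unit, gamma_unit).

Lemma mx_sum_unit M : M = \sum_i \sum_j unit_mx i j (M i j).
Proof. exact: matrix_sum_delta. Qed.

Lemma idem_mul_idem i j M : idem k i * M * idem k j = unit_mx i j (M i j).
Proof.
rewrite {1}[M]mx_sum_unit mulr_sumr (bigD1 i) //= [X in _ + X]big1 => [|l /negPf ne].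
  rewrite addr0 mulr_sumr mulr_suml (bigD1 j) //= [X in _ + X]big1 => [|l /negPf ne].
    by rewrite addr0 !idem_unit !unit_mxMM mul1r mulr1.
  by rewrite !idem_unit unit_mxMM unit_mxM ne.
by rewrite mulr_sumr big1 // => m _; rewrite !idem_unit unit_mxM eq_sym ne mulr0n.
Qed.

Lemma sum_idem : idem k v1 + idem k v2 + idem k v3 = 1.
Proof.
rewrite -sum_ord3; apply/matrixP => i j; rewrite summxE mxE.
rewrite (bigD1 i) //= big1 => [|l /negPf ne]; last by rewrite mxE eq_sym ne.
by rewrite addr0 mxE eqxx eq_sym.
Qed.

Lemma beta_exp m : beta k ^+ m.+1 = unit_mx v2 v2 'X^(m.+1).
Proof.
elim: m => [|m IHm]; first by rewrite expr1 beta_unit expr1.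
by rewrite exprS IHm beta_unit unit_mxMM -exprS.
Qed.

Lemma kQ_arrows : [/\ kQ (alpha k), kQ (beta k) & kQ (gamma k)].
Proof. by split; [exact: (kQ_arrow k v1) | exact: (kQ_arrow k v2) | exact: (kQ_arrow k v3)]. Qed.

Lemma kQ_unit22 p : kQ (unit_mx v2 v2 p).
Proof.
elim/poly_ind: p => [|p c IHp]; first by rewrite unit_mx0; constructor.
rewrite unit_mxD -(unit_mxMM _ v2); constructor.
  by constructor => //; rewrite -beta_unit; have [] := kQ_arrows.
by rewrite -[c%:P]mulr1 mul_polyC unit_mxZ -idem_unit; do 2 constructor.
Qed.

Lemma kQ_unit12 p : kQ (unit_mx v1 v2 p).
Proof.
rewrite -[p]mul1r -(unit_mxMM _ v2) -alpha_unit.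
by constructor; [have [] := kQ_arrows | exact: kQ_unit22].
Qed.

Lemma kQ_unit23 p : kQ (unit_mx v2 v3 p).
Proof.
rewrite -[p]mulr1 -(unit_mxMM _ v2) -gamma_unit.
by constructor; [exact: kQ_unit22 | have [] := kQ_arrows].
Qed.

Lemma kQ_unit13 p : kQ (unit_mx v1 v3 p).
Proof.
rewrite -[p]mulr1 -(unit_mxMM _ v2).
by constructor; [exact: kQ_unit12 | exact: kQ_unit23].
Qed.

Lemma kQ_unitC i (c : k) : kQ (unit_mx i i c%:P).
Proof. by rewrite -[c%:P]mulr1 mul_polyC unit_mxZ -idem_unit; do 2 constructor. Qed.

Lemma kQ_opp M : kQ M -> kQ (- M).
Proof. by move=> h; rewrite -scaleN1r -[- 1]/(- 1%:P) -polyCN; constructor. Qed.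

Lemma kQ_sub M N : kQ M -> kQ N -> kQ (M - N).
Proof. by move=> hM hN; constructor => //; exact: kQ_opp. Qed.

Definition kQ_shape M : Prop :=
  [/\ M v2 v1 = 0, M v3 v1 = 0 & M v3 v2 = 0] /\
  exists c1 c3 : k, M v1 v1 = c1%:P /\ M v3 v3 = c3%:P.

Lemma kQ_shapeP M : kQ M -> kQ_shape M.
Proof.
elim=> {M} [i|a| |M N _ [[e1 e2 e3] [c1 [c3 [f1 f3]]]] _ [[e1' e2' e3'] [c1' [c3' [f1' f3']]]]|
  c M _ [[e1 e2 e3] [c1 [c3 [f1 f3]]]]|
  M N _ [[e1 e2 e3] [c1 [c3 [f1 f3]]]] _ [[e1' e2' e3'] [c1' [c3' [f1' f3']]]]].
- rewrite idem_unit; case: (ord3P i) => ->; split; try (by split; rewrite unit_mxE).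
  + by exists 1, 0; rewrite !unit_mxE.
  + by exists 0, 0; rewrite !unit_mxE.
  + by exists 0, 1; rewrite !unit_mxE.
- have: [\/ arrow k a = alpha k, arrow k a = beta k | arrow k a = gamma k].
    by case: (ord3P a) => ->; [constructor 1 | constructor 2 | constructor 3].
  by case=> ->; rewrite !kQ_unit; split; [split|exists 0, 0|split|exists 0, 0|split|exists 0, 0];
     rewrite !unit_mxE.
- by split; [split; rewrite mxE | exists 0, 0; rewrite !mxE].
- split; first by split; rewrite mxE (e1, e2, e3) (e1', e2', e3') addr0.
  by exists (c1 + c1'), (c3 + c3'); rewrite !mxE f1 f1' f3 f3' !polyCD.
- split; first by split; rewrite mxE (e1, e2, e3) mulr0.
  by exists (c * c1), (c * c3); rewrite !mxE f1 f3 !polyCM.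
- split.
    by split; rewrite mulmx3E ?(e1, e2, e3) ?(e1', e2', e3') !(mul0r, mulr0, addr0).
  exists (c1 * c1'), (c3 * c3'); rewrite !mulmx3E e1' e2' e2 e3 f1 f1' f3 f3'.
  by rewrite !(mul0r, mulr0, addr0, add0r) !polyCM.
Qed.

Lemma kQ_of_shape M : kQ_shape M -> kQ M.
Proof.
case=> -[e1 e2 e3] [c1 [c3 [f1 f3]]].
rewrite [M]mx_sum_unit !sum_ord3 e1 e2 e3 f1 f3 !unit_mx0.
by repeat constructor; first [exact: kQ_unitC | exact: kQ_unit12 | exact: kQ_unit13
   | exact: kQ_unit22 | exact: kQ_unit23].
Qed.

End Entries.

Section Ideals.
Variable k : fieldType.
Implicit Types (p q : {poly k}) (M N : Mx k) (i j : 'I_3).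

Lemma poly_ideal_Xn (J : {poly k} -> Prop) (N : nat) :
  J 0 -> (forall p q, J p -> J q -> J (p + q)) ->
  (forall (c : k) p, J p -> J (c *: p)) -> (forall p, J p -> J (p * 'X)) ->
  J 'X^N -> exists n, forall p, J p <-> 'X^n %| p.
Proof.
move=> J0 JD JZ JX JN.
have JM q p : J p -> J (p * q).
  move=> Jp; elim/poly_ind: q => [|q c IHq]; first by rewrite mulr0.
  rewrite mulrDr mulrA; apply: JD; first exact: JX.
  by rewrite mulrC mul_polyC; apply: JZ.
have [g [Jg g0 ming]] : exists g, [/\ J g, g != 0 &
    forall p, J p -> p != 0 -> (size g <= size p)%N].
  apply: NNPP => noex.
  suff no s p : (size p <= s)%N -> J p -> p = 0.
    by move: (no _ _ (leqnn _) JN) => /eqP; rewrite -size_poly_eq0 size_polyXn.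
  elim: s p => [|s IHs] p; first by rewrite leqn0 size_poly_eq0 => /eqP.
  move=> sp Jp; apply/eqP/negP => /negP p0; apply: noex; exists p; split=> // q Jq q0.
  rewrite leqNgt; apply/negP => sqp; move/negP: q0; apply; apply/eqP.
  by apply: IHs Jq; rewrite -ltnS (leq_trans sqp).
have Jdvd p : J p -> g %| p.
  move=> Jp; apply/modp_eq0P/eqP/negP => /negP m0.
  have Jm : J (p %% g).
    rewrite -[p %% g](addKr (p %/ g * g)) -divp_eq addrC; apply: JD => //.
    by rewrite -scaleN1r mulrC; apply/JZ/JM.
  by have := ming _ Jm m0; rewrite leqNgt ltn_modp g0.
have [n _ eg] : exists2 n, (n <= N)%N & g %= ('X - 0%:P) ^+ n.
  by apply: dvdp_exp_XsubCP; rewrite subr0 Jdvd.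
rewrite subr0 in eg.
exists n => p; rewrite -(eqp_dvdl _ eg); split; first exact: Jdvd.
by move=> /divpK <-; rewrite mulrC; apply: JM.
Qed.

Variable I : Mx k -> Prop.
Hypothesis I_ideal : is_ideal I.

Lemma ideal0 : I 0. Proof. by case: I_ideal => _ []. Qed.
Lemma idealD M N : I M -> I N -> I (M + N).
Proof. by case: I_ideal => _ [_ [h _]]; apply: h. Qed.
Lemma idealZ (c : k) M : I M -> I (c%:P *: M).
Proof. by case: I_ideal => _ [_ [_ [h _]]]; apply: h. Qed.
Lemma idealMl M N : kQ M -> I N -> I (M * N).
Proof. by case: I_ideal => _ [_ [_ [_ h]]] kM IN; case: (h M N kM IN). Qed.
Lemma idealMr M N : kQ N -> I M -> I (M * N).
Proof. by case: I_ideal => _ [_ [_ [_ h]]] kN IM; case: (h N M kN IM). Qed.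
Lemma ideal_kQ M : I M -> kQ M.
Proof. by case: I_ideal => h _; apply: h. Qed.
Lemma idealN M : I M -> I (- M).
Proof. by move=> h; rewrite -scaleN1r -[- 1]/(- 1%:P) -polyCN; apply: idealZ. Qed.
Lemma idealB M N : I M -> I N -> I (M - N).
Proof. by move=> IM IN; apply: idealD => //; apply: idealN. Qed.

Lemma ideal_entry M i j : I M -> I (unit_mx i j (M i j)).
Proof.
by move=> IM; rewrite -idem_mul_idem; apply: idealMr; [constructor |
   apply: idealMl => //; constructor].
Qed.

Lemma ideal_of_entries M : (forall i j, I (unit_mx i j (M i j))) -> I M.
Proof.
move=> h; rewrite [M]mx_sum_unit.
have add_closed := big_ind I ideal0 idealD.
by apply: (add_closed) => i _; apply: (add_closed).
Qed.

Lemma ideal_unitM (i j l : 'I_3) p q : kQ (unit_mx j l q) ->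
  I (unit_mx i j p) -> I (unit_mx i l (p * q)).
Proof. by move=> kq Ip; rewrite -(unit_mxMM _ j); apply: idealMr. Qed.

Lemma ideal_Munit (i j l : 'I_3) p q : kQ (unit_mx i j p) ->
  I (unit_mx j l q) -> I (unit_mx i l (p * q)).
Proof. by move=> kp Iq; rewrite -(unit_mxMM _ j); apply: idealMl. Qed.

End Ideals.

Section Admissible.
Variable k : fieldType.
Implicit Types (p q : {poly k}) (M N : Mx k) (i j : 'I_3).

Definition length2_ideal M :=
  [/\ kQ M, M v1 v1 = 0, M v3 v3 = 0, 'X^2 %| M v2 v2 & 'X %| M v1 v2 /\ 'X %| M v2 v3].

Lemma length2_ideal_is_ideal : is_ideal length2_ideal.
Proof.
split; first by move=> M [].
split; first by split; rewrite ?mxE ?dvdp0 //; constructor.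
split.
  move=> M N [kM a b c [d e]] [kN a' b' c' [d' e']].
  split; first exact: kQ_add.
  1-4: by rewrite ?mxE ?a ?b ?a' ?b' ?addr0 //; split || idtac; rewrite dvdp_add.
split.
  move=> c M [kM a b e [d f]].
  split; first exact: kQ_scale.
  1-4: by rewrite ?mxE ?a ?b ?mulr0 //; split || idtac; rewrite dvdp_mull.
move=> M N kM [kN a b c [d e]].
have [[e1 e2 e3] _] := kQ_shapeP kM; have [[e1' e2' e3'] _] := kQ_shapeP kN.
have dX p : 'X^2 %| p -> 'X %| p by apply: dvdp_trans; rewrite expr2 dvdp_mulr.
split; split; try exact: kQ_mul.
all: rewrite !mulmx3E ?e1 ?e2 ?e3 ?e1' ?e2' ?e3' ?a ?b ?mul0r ?mulr0 ?addr0 ?add0r //.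
- exact: dvdp_mull.
- by split; [apply: dvdp_add; apply: dvdp_mull => //; apply: dX | apply: dvdp_mull].
- exact: dvdp_mulr.
- by split; [apply: dvdp_mulr | apply: dvdp_add; apply: dvdp_mulr => //; apply: dX].
Qed.

Lemma length2_ideal_words (w : seq 'I_3) : size w = 2%N ->
  length2_ideal (\prod_(a <- w) arrow k a).
Proof.
case: w => [|a [|b [|//]]] // _; rewrite !big_cons big_nil mulr1.
split; first by constructor; constructor.
all: case: (ord3P a) => ->; case: (ord3P b) => ->.
all: rewrite /arrow /= ?kQ_unit ?unit_mxM ?unit_mxMM /= ?mulr0n ?mulr1n ?unit_mxE ?mxE /=.
all: by rewrite ?mulr0n ?mulr1n ?mul1r ?mulr1 ?dvdp0 ?dvdpp -?expr2 ?dvdpp.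
Qed.

Lemma gen_ideal_sub (S : Mx k -> Prop) J M :
  is_ideal J -> (forall s, S s -> J s) -> gen_ideal S M -> J M.
Proof. by move=> hJ hS; apply. Qed.

Record exponents (I : Mx k -> Prop) (a b n : nat) : Prop := Exponents {
  exp_n_ge2 : (2 <= n)%N;
  exp_a_le : (a <= n)%N;
  exp_b_gt0 : (0 < b)%N;
  exp_b_le : (b <= n)%N;
  exp_diag : forall M, I M -> M v1 v1 = 0 /\ M v3 v3 = 0;
  exp_22 : forall p, I (unit_mx v2 v2 p) <-> 'X^n %| p;
  exp_12 : forall p, I (unit_mx v1 v2 p) <-> 'X^a %| p;
  exp_23 : forall p, I (unit_mx v2 v3 p) <-> 'X^b %| p }.

Lemma admissible_exponents (I : Mx k -> Prop) : admissible I ->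
  exists a b n, exponents I a b n.
Proof.
case=> hI [N [N2 [Nsub sub2]]].
have le2 M : I M -> length2_ideal M.
  move=> /sub2; apply: gen_ideal_sub; first exact: length2_ideal_is_ideal.
  by move=> s [w [sw ->]]; apply: length2_ideal_words.
have kQb : kQ (unit_mx v2 v2 ('X : {poly k})) by exact: kQ_unit22.
have bN : I (unit_mx v2 v2 'X^N).
  case: N N2 Nsub => // N _ Nsub; apply: Nsub => J hJ; apply; exists (nseq N.+1 v2).
  split; first by rewrite size_nseq.
  by rewrite big_nseq -beta_exp -iter_mulr_1.
have aN : I (unit_mx v1 v2 'X^N).
  by rewrite -['X^N]mul1r; apply: (ideal_Munit hI _ bN); exact: kQ_unit12.
have gN : I (unit_mx v2 v3 'X^N).
  by rewrite -['X^N]mulr1; apply: (ideal_unitM hI _ bN); exact: kQ_unit23.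
have ext i j (J := fun p => I (unit_mx i j p)) : (forall p, J p -> J (p * 'X)) -> J 'X^N ->
    exists n, forall p, J p <-> 'X^n %| p.
  move=> JX; apply: poly_ideal_Xn => //.
  - by rewrite /J unit_mx0; apply: ideal0.
  - by move=> p q Jp Jq; rewrite /J unit_mxD; apply: idealD.
  - by move=> c p Jp; rewrite /J unit_mxZ; apply: idealZ.
have [n hn] := ext v2 v2 (fun p => ideal_unitM hI kQb (p := p)) bN.
have [a ha] := ext v1 v2 (fun p => ideal_unitM hI kQb (p := p)) aN.
have [b hb] : exists b, forall p, I (unit_mx v2 v3 p) <-> 'X^b %| p.
  by apply: ext gN => p; rewrite mulrC; apply: ideal_Munit.
have XX r s : ('X^r %| ('X^s : {poly k})) = (r <= s)%N.
  by rewrite dvdp_Pexp2l // size_polyX.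
have Xn (m : nat) : 'X^m %| ('X^m : {poly k}) by [].
exists a, b, n; split=> //.
- by have [_ _ _ + _] := le2 _ ((hn _).2 (Xn n)); rewrite unit_mxE !eqxx XX.
- rewrite -XX; apply/ha; rewrite -['X^n]mul1r; apply: (ideal_Munit hI (kQ_unit12 _)).
  exact/hn.
- by have [_ _ _ _ [_ +]] := le2 _ ((hb _).2 (Xn b)); rewrite unit_mxE !eqxx -['X]expr1 XX.
- rewrite -XX; apply/hb; rewrite -['X^n]mulr1; apply: (ideal_unitM hI (kQ_unit23 _)).
  exact/hn.
- by move=> M /le2 [].
Qed.

End Admissible.

(** * Outer derivations *)

Section Outer.
Variable k : fieldType.
Implicit Types (p q h g : {poly k}) (M N : Mx k) (i j : 'I_3) (d : 'I_3 -> {poly k}).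

Lemma entryB M N i j : (M - N) i j = M i j - N i j. Proof. by rewrite !mxE. Qed.

Definition outer_der h d M : Mx k :=
  \matrix_(i, j) (h * (M i j)^`() + M i j * (d j - d i)).

Lemma outer_derE h d M i j :
  outer_der h d M i j = h * (M i j)^`() + M i j * (d j - d i).
Proof. by rewrite mxE. Qed.

Lemma outer_der_linear h d (c : k) M N :
  outer_der h d (c%:P *: M + N) = c%:P *: outer_der h d M + outer_der h d N.
Proof.
apply/matrixP => i j; rewrite !mxE mul_polyC derivD derivZ -[c *: M i j]mul_polyC.
by rewrite -mul_polyC; ring.
Qed.

Lemma outer_derB h d M N : outer_der h d (M - N) = outer_der h d M - outer_der h d N.
Proof. by apply/matrixP => i j; rewrite !mxE derivB; ring. Qed.

Lemma outer_der_mul h d M N :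
  outer_der h d (M * N) = outer_der h d M * N + M * outer_der h d N.
Proof.
apply/matrixP => i j; rewrite outer_derE [in RHS]mxE !mulmx3E !outer_derE.
by rewrite !derivD !derivM; ring.
Qed.

Lemma outer_der_kQ h d M : kQ M -> kQ (outer_der h d M).
Proof.
move=> /kQ_shapeP[[e1 e2 e3] [c1 [c3 [f1 f3]]]]; apply: kQ_of_shape; split.
  by split; rewrite outer_derE (e1, e2, e3) deriv0 mulr0 mul0r addr0.
by exists 0, 0; rewrite !outer_derE f1 f3 !derivC !subrr !mulr0 addr0.
Qed.

Lemma outer_derivation I h d : is_ideal I ->
  (forall M, I M -> I (outer_der h d M)) -> is_derivation I (outer_der h d).
Proof.
move=> hI stab; split; first exact: outer_der_kQ.
split; first by move=> M N _ _ IMN; rewrite -outer_derB; apply: stab.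
split=> [c M N _ _|M N _ _]; first by rewrite outer_der_linear subrr; apply: ideal0.
by rewrite outer_der_mul subrr; apply: ideal0.
Qed.

Lemma dvdp_Xn_deriv m h p : 'X %| h -> 'X^m %| p -> 'X^m %| h * p^`().
Proof.
move=> /dvdpP[h' ->] /dvdpP[q ->]; rewrite derivM derivXn mulrDr.
apply: dvdp_add; first by rewrite mulrA dvdp_mull.
case: m => [|m]; first by rewrite expr0 dvd1p.
rewrite [_.-1]/=.
have -> : h' * 'X * (q * ('X^m *+ m.+1)) = h' * q *+ m.+1 * ('X * 'X^m).
  by rewrite -mulr_natr -[in RHS]mulr_natr; ring.
by rewrite -exprS dvdp_mull.
Qed.

Lemma dvdp_XnP m p : reflect (forall l : nat, (l < m)%N -> p`_l = 0) ('X^m %| p).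
Proof.
apply: (iffP idP) => [/dvdpP[q ->] i im|p0]; first by rewrite coefMXn im.
rewrite -(poly_take_drop m p) (_ : take_poly m p = 0) ?add0r ?dvdp_mull //.
apply/polyP => i; rewrite coef_take_poly coef0; case: ltnP => [lt_im|//]; exact: p0.
Qed.

Lemma dvdp_XnXn r s : ('X^r %| ('X^s : {poly k})) = (r <= s)%N.
Proof. by rewrite dvdp_Pexp2l // size_polyX. Qed.

Section Vanishing.
Variables (I : Mx k -> Prop) (a b n : nat).
Hypotheses (hI : is_ideal I) (hexp : exponents I a b n) (hHH : HH1_vanishes I).

Lemma exponents_13 p : 'X^a %| p \/ 'X^b %| p -> I (unit_mx v1 v3 p).
Proof.
case=> [/(exp_12 hexp) Ip|/(exp_23 hexp) Ip].
  by rewrite -[p]mulr1; apply: (ideal_unitM hI _ Ip); exact: kQ_unit23.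
by rewrite -[p]mul1r; apply: (ideal_Munit hI _ Ip); exact: kQ_unit12.
Qed.

Lemma HH1_vanishes_rigid h g : 'X %| h ->
  (forall p, I (unit_mx v1 v3 p) -> I (unit_mx v1 v3 (h * p^`() + p * g))) ->
  'X^n %| h /\ exists c : k, 'X^(minn a b) %| g - c%:P.
Proof.
move=> Xh stab.
pose d (i : 'I_3) : {poly k} := if i == v3 then g else 0.
have /hHH[x [kx inner]] : is_derivation I (outer_der h d).
  apply: outer_derivation => // M IM; apply: ideal_of_entries => // i j.
  have IMij := ideal_entry hI i j IM; rewrite outer_derE.
  have [[e1 e2 e3] _] := kQ_shapeP (ideal_kQ hI IM).
  have [f1 f3] := exp_diag hexp IM.
  case: (ord3P i) IMij => ->; case: (ord3P j) => ->;
    rewrite ?(e1, e2, e3, f1, f3) ?deriv0 ?mul0r ?mulr0 ?addr0 /d /= ?subr0 ?mulr0 ?addr0 //;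
    rewrite ?unit_mx0 //.
  - by move=> /(exp_12 hexp) ?; apply/(exp_12 hexp)/dvdp_Xn_deriv.
  - exact: stab.
  - by move=> /(exp_22 hexp) ?; apply/(exp_22 hexp)/dvdp_Xn_deriv.
  - move=> /(exp_23 hexp) ?; apply/(exp_23 hexp)/dvdp_add; first exact: dvdp_Xn_deriv.
    exact: dvdp_mulr.
have [[x21 x31 x32] [c1 [c3 [x11 x33]]]] := kQ_shapeP kx.
have [ka kb kc] := kQ_arrows k.
split.
  have := ideal_entry hI v2 v2 (inner _ kb) => /(exp_22 hexp).
  rewrite beta_unit !entryB outer_derE !mulmx3E !unit_mxE /d /=.
  rewrite !(subrr, mulr1n, mulr0n, mulr0, mul0r, add0r, addr0, mulr1).
  by rewrite derivX mulr1 ['X * _]mulrC subrr subr0.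
exists (c1 - c3).
have /(exp_12 hexp) := ideal_entry hI v1 v2 (inner _ ka).
have /(exp_23 hexp) := ideal_entry hI v2 v3 (inner _ kc).
rewrite alpha_unit gamma_unit !entryB !outer_derE !mulmx3E !unit_mxE.
rewrite x11 x33 /d /= !(mulr1n, mulr0n, mulr0, mul0r, add0r, addr0, mulr1, mul1r, subr0).
rewrite -polyC1 derivC => db da.
have -> : g - (c1 - c3)%:P = (h * 0 + g - (x v2 v2 - c3%:P)) + (h * 0 - (c1%:P - x v2 v2)).
  by rewrite polyCB; ring.
by apply: dvdp_add; [apply: dvdp_trans db | apply: dvdp_trans da];
  rewrite dvdp_XnXn (geq_minr, geq_minl).
Qed.

Lemma HH1_vanishes_full_exponents : a = n /\ b = n.
Proof.
have n2 := exp_n_ge2 hexp; have an := exp_a_le hexp; have bn := exp_b_le hexp.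
suff : (n <= minn a b)%N by lia.
rewrite leqNgt; apply/negP => lt_n.
have [] := @HH1_vanishes_rigid 'X^(n.-1) 0.
- by rewrite -['X in X in X %| _]expr1 dvdp_XnXn; lia.
- move=> p _; rewrite mulr0 addr0; apply: exponents_13.
  by case: (leqP a b) => ab; [left | right]; apply: dvdp_mulr; rewrite dvdp_XnXn; lia.
- by rewrite dvdp_XnXn; lia.
Qed.

Let W p := I (unit_mx v1 v3 p).

Lemma ideal13_mod p q : W p -> 'X^n %| q - p -> W q.
Proof.
have [ea eb] := HH1_vanishes_full_exponents.
move=> Wp dpq; rewrite -[q](subrK p) /W unit_mxD; apply: (idealD hI) => //.
by apply: exponents_13; left; rewrite ea.
Qed.

Lemma ideal13Z (c : k) p : W p -> W (c *: p).
Proof. by rewrite /W unit_mxZ; apply: idealZ. Qed.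

Lemma ideal13D p q : W p -> W q -> W (p + q).
Proof. by rewrite /W unit_mxD; apply: idealD. Qed.

Lemma HH1_vanishes_ge4 : (4 <= n)%N.
Proof.
have [ea eb] := HH1_vanishes_full_exponents.
have n2 := exp_n_ge2 hexp.
have Wmod := ideal13_mod; have WZ := ideal13Z; have WD := ideal13D.
have W0 p : 'X^n %| p -> W p by move=> ?; apply: exponents_13; left; rewrite ea.
have [w Ww w1] : exists2 w, W w & ~ W (w * 'X^(n.-1)).
  apply: NNPP => noex.
  have [] := @HH1_vanishes_rigid 0 'X^(n.-1); first by rewrite dvdp0.
    by move=> p Wp; rewrite mul0r add0r; apply: NNPP => nW; apply: noex; exists p.
  move=> _ [c]; rewrite ea eb minnn => /dvdp_XnP/(_ n.-1).
  rewrite coefB coefXn eqxx coefC; case: eqP => [|_ /(_ _)/eqP]; first by lia.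
  by rewrite subr0 oner_eq0 => h; apply: notF; apply: h; lia.
have low p : 'X^n %| p * 'X^(n.-1) - p`_0 *: 'X^(n.-1).
  apply/dvdp_XnP => i lt_in; rewrite coefB coefMXn coefZ coefXn.
  case: ltnP => ilt; first by rewrite ltn_eqF // mulr0 subrr.
  by rewrite (_ : i = n.-1) ?eqxx ?subnn ?mulr1 ?subrr //; lia.
have nWX : ~ W 'X^(n.-1).
  by move=> WX; apply: w1; apply: Wmod (low w); apply: WZ.
have w0 : w`_0 != 0.
  apply/eqP => w0; apply: w1; apply: W0.
  by have := low w; rewrite w0 scale0r subr0.
wlog w01 : w Ww w1 w0 / w`_0 = 1.
  move/(_ ((w`_0)^-1 *: w)); apply; rewrite ?coefZ ?mulVf ?oner_eq0 //.
    exact: WZ.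
  rewrite -scalerAl => /(WZ (w`_0)); rewrite scalerA divff // scale1r.
  exact: w1.
rewrite leqNgt; apply/negP => n4.
have Xh : 'X %| ('X^(n.-1) : {poly k}) by rewrite -['X in X in X %| _]expr1 dvdp_XnXn; lia.
have [lin|] := classic (forall p, W p -> p`_1 = p`_0 * w`_1).
  have [] := @HH1_vanishes_rigid 'X^(n.-1) (- (w`_1 *: 'X^(n.-1))) Xh.
    move=> p Wp; apply: W0; apply/dvdp_XnP => i lt_in.
    rewrite mulrN -scalerAr [p * _]mulrC coefB coefZ !coefXnM.
    case: ltnP => ilt; first by rewrite mulr0 subrr.
    rewrite (_ : i = n.-1) ?subnn; last by lia.
    by rewrite coef_deriv mulr1n (lin p Wp) mulrC subrr.
  by rewrite dvdp_XnXn; lia.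
move=> /not_all_ex_not[p nlin]; have [Wp /eqP] := imply_to_and _ _ nlin; rewrite -subr_eq0.
set e := _ - _ => e0.
have [r [Wr r0 r1]] : exists r, [/\ W r, r`_0 = 0 & r`_1 = 1].
  exists (e^-1 *: (p - p`_0 *: w)); split.
  - by apply: (WZ); apply: (WD) => //; rewrite -scaleNr; apply: (WZ).
  - by rewrite coefZ coefB coefZ w01 mulr1 subrr mulr0.
  - by rewrite coefZ coefB coefZ mulVf.
have [n3|n2'] : n = 3 \/ n = 2 by lia.
  have [] := @HH1_vanishes_rigid (- 'X^2) ('X + r`_2 *: 'X^2).
  - by rewrite dvdpNr expr2 dvdp_mulr.
  - move=> q Wq; apply: (Wmod (q`_0 *: r)); first exact: WZ.
    rewrite n3; apply/dvdp_XnP => i.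
    rewrite mulrDr -scalerAr mulNr [q * 'X^2]mulrC !(coefB, coefD, coefN, coefZ, coefXnM, coefMX).
    case: i => [|[|[|//]]] _ /=; rewrite ?r0 ?r1 ?coef_deriv ?subnn ?mulr1n; ring.
  - by rewrite dvdpNr dvdp_XnXn n3.
by apply: nWX; apply: Wmod Wr _; rewrite n2' expr1; apply/dvdp_XnP => -[|[|//]] _;
  rewrite coefB coefX ?r0 ?r1 ?subrr //= subr0.
Qed.

End Vanishing.
End Outer.

(** * An ideal with vanishing HH^1 *)

Section Rigid.
Variable k : fieldType.
Implicit Types (p q h g : {poly k}) (M N : Mx k) (i j : 'I_3) (d : 'I_3 -> {poly k}).

Definition rigid_space p : Prop :=
  [/\ p`_3 = 0, p`_4 = 0, p`_6 = 0, p`_5 = p`_2 & p`_7 = p`_2].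

Lemma rigid_space_low p : 'X^8 %| p -> rigid_space p.
Proof. by move=> /dvdp_XnP p0; split; rewrite !p0. Qed.

Lemma rigid_spaceD p q : rigid_space p -> rigid_space q -> rigid_space (p + q).
Proof.
by move=> [a3 a4 a6 a5 a7] [b3 b4 b6 b5 b7]; split;
  rewrite !coefD ?a3 ?a4 ?a6 ?a5 ?a7 ?b3 ?b4 ?b6 ?b5 ?b7 ?addr0.
Qed.

Lemma rigid_spaceM (c : k) p : rigid_space p -> rigid_space (c%:P * p).
Proof.
by move=> [a3 a4 a6 a5 a7]; split; rewrite !coefCM ?a3 ?a4 ?a6 ?a5 ?a7 ?mulr0.
Qed.

(* The coefficients of [h p' + p g] for [p = 1, X, X^2 + X^5 + X^7], the basis of [rigid_space]
   modulo [X^8]. *)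
Lemma rigid_system (h0 h1 h2 h3 h5 h6 g0 g1 g2 : k) :
  h0 *+ 8 = 0 -> h3 + g2 = 0 -> h6 + g2 = 0 -> h5 = h2 + g1 ->
  h2 *+ 2 + g1 = 0 -> h3 *+ 2 + h0 *+ 5 + g2 = 0 ->
  h5 *+ 2 + h2 *+ 5 + h0 *+ 7 + g1 = 0 ->
  h1 *+ 5 + g0 = h1 *+ 2 + g0 ->
  h6 *+ 2 + h3 *+ 5 + h1 *+ 7 + g2 *+ 2 + g0 = h1 *+ 2 + g0 ->
  [/\ h0 = 0, h1 = 0, h2 = 0, h3 = 0 & g1 = 0 /\ g2 = 0].
Proof.
move=> u8 /eqP; rewrite addr_eq0 => /eqP -> /eqP; rewrite addr_eq0 => /eqP -> ->.
move=> /eqP; rewrite addrC addr_eq0 => /eqP -> c4 c6.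
move=> /eqP; rewrite -subr_eq0 => /eqP c5 /eqP; rewrite -subr_eq0 => /eqP c7.
have s5 : g2 = h0 *+ 5 by rewrite -[g2]addr0 -c4; ring.
have v3 : h1 *+ 3 = 0 by rewrite -c5; ring.
have v5 : h1 *+ 5 = h0 *+ 25 by rewrite -[RHS]addr0 -c7 s5; ring.
have h00 : h0 = 0.
  have -> : h0 = (h0 *+ 25) *+ 9 - (h0 *+ 8) *+ 28 by ring.
  rewrite u8 -v5 (_ : _ *+ 9 = (h1 *+ 3) *+ 15); last by ring.
  by rewrite v3 !mul0rn subrr.
have h10 : h1 = 0.
  have -> : h1 = (h1 *+ 3) *+ 2 - h1 *+ 5 by ring.
  by rewrite v3 v5 h00 !mul0rn subrr.
have h20 : h2 = 0 by rewrite -c6 h00; ring.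
by rewrite s5 h00 h10 h20 !mul0rn oppr0.
Qed.

Lemma rigid_spaceP h g : h`_0 *+ 8 = 0 ->
  (forall p, rigid_space p -> rigid_space (h * p^`() + p * g)) ->
  'X^8 %| h /\ 'X^8 %| g - (g`_0)%:P.
Proof.
move=> h0 stab.
have [] := stab 1.
  by split; rewrite -polyC1 !coefC.
rewrite -polyC1 derivC mulr0 add0r polyC1 mul1r => g3 g4 g6 g5 g7.
have [] := stab 'X.
  by split; rewrite !coefX.
rewrite derivX mulr1 !(coefD, coefXM) /= g3 g4 g5 g6 !addr0 => h3 h4 h6 h5 h7.
have [] := stab ('X^2 + 'X^5 + 'X^7).
  by split; rewrite !(coefD, coefXn) /= ?addr0 ?add0r.
have -> : h * ('X^2 + 'X^5 + 'X^7)^`() + ('X^2 + 'X^5 + 'X^7) * g =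
    h * 'X *+ 2 + h * 'X^4 *+ 5 + h * 'X^6 *+ 7 + (g * 'X^2 + g * 'X^5 + g * 'X^7).
  by rewrite !derivD !derivXn /= expr1; ring.
rewrite !(coefD, coefMn, coefMXn, coefMX) /= !subSS !subn0.
rewrite h4 g3 g4 g5 => c3 c4 c6 c5 c7.
have [h00 h10 h20 h30 [g10 g20]] : [/\ h`_0 = 0, h`_1 = 0, h`_2 = 0, h`_3 = 0 &
    g`_1 = 0 /\ g`_2 = 0].
  apply: (rigid_system (h5 := h`_5) (h6 := h`_6) (g0 := g`_0)) => //.
  - by apply: etrans c3; ring.
  - by apply: etrans c4; ring.
  - by apply: etrans c6; ring.
  - by apply: etrans (etrans _ c5) _; ring.
  - by apply: etrans (etrans _ c7) _; ring.
have h60 : h`_6 = 0 by apply/eqP; move/eqP: h6; rewrite g20 addr0.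
have h50 : h`_5 = 0 by rewrite h5 h20 g10 addr0.
have h70 : h`_7 = 0 by rewrite h7 h20 g10 addr0.
split; apply/dvdp_XnP => -[|[|[|[|[|[|[|[|//]]]]]]]] _;
  by rewrite ?coefB ?coefC /= ?subr0 ?subrr ?g7 ?g5.
Qed.

Definition rigid_ideal M : Prop :=
  [/\ kQ M, M v1 v1 = 0 /\ M v3 v3 = 0, 'X^8 %| M v2 v2,
      'X^8 %| M v1 v2 /\ 'X^8 %| M v2 v3 & rigid_space (M v1 v3)].

Lemma rigid_ideal_is_ideal : is_ideal rigid_ideal.
Proof.
split; first by move=> M [].
split.
  by split; rewrite ?mxE ?dvdp0 //; [constructor | apply: rigid_space_low; rewrite dvdp0].
split.
  move=> M N [kM [a b] c [d e] f] [kN [a' b'] c' [d' e'] f'].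
  split; rewrite ?mxE; [exact: kQ_add | by rewrite a b a' b' addr0 | exact: dvdp_add |
    by split; apply: dvdp_add | exact: rigid_spaceD].
split.
  move=> l M [kM [a b] c [d e] f].
  split; rewrite ?mxE; [exact: kQ_scale | by rewrite a b mulr0 | exact: dvdp_mull |
    by split; apply: dvdp_mull | exact: rigid_spaceM].
move=> M N kM [kN [a b] c [d e] f].
have [[e1 e2 e3] [c1 [c3 [f1 f3]]]] := kQ_shapeP kM.
have [[e1' e2' e3'] _] := kQ_shapeP kN.
split; split; try exact: kQ_mul.
all: rewrite !mulmx3E ?e1 ?e2 ?e3 ?e1' ?e2' ?e3' ?a ?b ?mul0r ?mulr0 ?addr0 ?add0r //.
- exact: dvdp_mull.
- by split; [apply: dvdp_add; apply: dvdp_mull | apply: dvdp_mull].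
- rewrite f1; apply: rigid_spaceD; first exact: rigid_spaceM.
  by apply: rigid_space_low; apply: dvdp_mull.
- exact: dvdp_mulr.
- by split; [apply: dvdp_mulr | apply: dvdp_add; apply: dvdp_mulr].
- rewrite f3 [N v1 v3 * _]mulrC; apply: rigid_spaceD; last exact: rigid_spaceM.
  by apply: rigid_space_low; apply: dvdp_mulr.
Qed.

Lemma arrow_word_entries (w : seq 'I_3) (M := \prod_(a <- w) arrow k a) : (0 < size w)%N ->
  [/\ kQ M, M v1 v1 = 0 /\ M v3 v3 = 0, 'X^(size w) %| M v2 v2,
      'X^((size w).-1) %| M v1 v2 /\ 'X^((size w).-1) %| M v2 v3 &
      'X^((size w).-2) %| M v1 v3].
Proof.
rewrite {}/M; elim: w => // a [|b w] IHw _.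
  rewrite big_cons big_nil mulr1 /= !expr0 !dvd1p; split=> //; first exact: kQ_arrow.
    by case: (ord3P a) => ->; rewrite /arrow /= ?kQ_unit !unit_mxE.
  by case: (ord3P a) => ->; rewrite /arrow /= ?kQ_unit unit_mxE ?dvdp0 ?dvdpp.
rewrite big_cons; move: (IHw isT); move: (\prod_(_ <- _ :: _) _) => {IHw} M.
rewrite /=; move: (size w) => m [kM [M11 M33] M22 [M12 M23] M13].
have [[e1 e2 e3] _] := kQ_shapeP kM.
have dS (r : nat) p : 'X^r %| p -> 'X^(r.+1) %| 'X * p by rewrite exprS => ?; apply: dvdp_mul.
split; first by apply: kQ_mul => //; exact: kQ_arrow.
all: case: (ord3P a) => ->; rewrite /arrow /= ?kQ_unit !mulmx3E !unit_mxE /=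
  !(mulr1n, mulr0n, mul0r, addr0, add0r, mul1r, dvdp0) ?e1 ?e2 ?e3 ?M33 ?dvdp0 ?mulr0 //.
- exact: dS.
- by split=> //; apply: dS.
Qed.

Lemma rigid_ideal_admissible : admissible rigid_ideal.
Proof.
have hI := rigid_ideal_is_ideal; split=> //; exists 10; split=> //; split.
  move=> M; apply: gen_ideal_sub => // _ [w [sw ->]].
  have [|kM dM M22 [M12 M23] M13] := @arrow_word_entries w; first by rewrite sw.
  rewrite sw in M22 M12 M23 M13.
  have le8 m p : (8 <= m)%N -> 'X^m %| p -> 'X^8 %| p.
    by move=> m8; apply: dvdp_trans; rewrite dvdp_XnXn.
  by split=> //; [exact: le8 M22 | split; [exact: le8 M12 | exact: le8 M23] |
    apply: rigid_space_low; exact: le8 M13].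
move=> M [kM [M11 M33] M22 [M12 M23] _] J hJ words.
have word2 a b : J (arrow k a * arrow k b).
  by apply: words; exists [:: a; b]; rewrite !big_cons big_nil mulr1.
have Xdvd (m : nat) p : 'X^(m.+1) %| p -> exists q, p = 'X^(m.+1) * q.
  by move=> /dvdpP[q ->]; exists q; rewrite mulrC.
have [[M21 M31 M32] _] := kQ_shapeP kM.
apply: ideal_of_entries => // i j.
case: (ord3P i) => ->; case: (ord3P j) => ->;
  rewrite ?(M11, M33, M21, M31, M32) ?unit_mx0; try exact: ideal0.
- have [q ->] := Xdvd _ _ M12; rewrite exprS -mulrA.
  have -> : unit_mx v1 v2 ('X * ('X^7 * q)) = arrow k v1 * arrow k v2 * unit_mx v2 v2 ('X^7 * q).
    by rewrite /arrow /= !kQ_unit !unit_mxMM mul1r.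
  by apply: (idealMr hJ) => //; exact: kQ_unit22.
- elim/poly_ind: (M v1 v3) => [|q c _]; first by rewrite unit_mx0; apply: ideal0.
  rewrite unit_mxD -[c%:P]mulr1 mul_polyC unit_mxZ; apply: (idealD hJ).
    have -> : unit_mx v1 v3 (q * 'X) = arrow k v1 * arrow k v2 * unit_mx v2 v3 q.
      by rewrite /arrow /= !kQ_unit !unit_mxMM mul1r mulrC.
    by apply: (idealMr hJ) => //; exact: kQ_unit23.
  apply: (idealZ hJ); have := word2 v1 v3.
  by rewrite /arrow /= !kQ_unit unit_mxMM mul1r.
- have [q ->] := Xdvd _ _ M22; rewrite (_ : 'X^8 * q = 'X * ('X * ('X^6 * q))); last by ring.
  have -> : unit_mx v2 v2 ('X * ('X * ('X^6 * q))) =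
      arrow k v2 * arrow k v2 * unit_mx v2 v2 ('X^6 * q).
    by rewrite /arrow /= !kQ_unit !unit_mxMM mulrA.
  by apply: (idealMr hJ) => //; exact: kQ_unit22.
- have [q ->] := Xdvd _ _ M23; rewrite exprSr -mulrA.
  have -> : unit_mx v2 v3 ('X^7 * ('X * q)) =
      unit_mx v2 v2 ('X^7 * q) * (arrow k v2 * arrow k v3).
    by rewrite /arrow /= !kQ_unit !unit_mxMM mulr1; congr unit_mx; ring.
  by apply: (idealMl hJ) => //; exact: kQ_unit22.
Qed.

End Rigid.

Section Derivations.
Variables (k : fieldType) (I : Mx k -> Prop).
Hypothesis hI : is_ideal I.
Implicit Types (D : Mx k -> Mx k) (M N x : Mx k).

Lemma entryD M N i j : (M + N) i j = M i j + N i j. Proof. by rewrite mxE. Qed.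
Lemma entryN M i j : (- M) i j = - M i j. Proof. by rewrite mxE. Qed.
Lemma entryZ p M i j : (p *: M) i j = p * M i j. Proof. by rewrite mxE. Qed.

Local Ltac mx3_ring :=
  apply/matrixP => ? ?; rewrite ?(entryD, entryN, entryZ, mulmx3E); ring.

Lemma derivation0 D : is_derivation I D -> I (D 0).
Proof.
move=> [kD [_ [lin _]]].
have := lin (-1) 0 0 (kQ_zero k) (kQ_zero k).
by rewrite scaler0 addr0 polyCN scaleN1r addNr subr0.
Qed.

Lemma derivation_ideal D M : is_derivation I D -> I M -> I (D M).
Proof.
move=> hD IM; have [_ [wd _]] := hD.
have := wd M 0 (ideal_kQ hI IM) (kQ_zero k); rewrite subr0 => /(_ IM) h.
by rewrite -[D M](subrK (D 0)); apply: (idealD hI) => //; apply: derivation0.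
Qed.

Lemma derivation_sub_inner D x : is_derivation I D -> kQ x ->
  is_derivation I (fun M => D M - (x * M - M * x)).
Proof.
move=> [kD [wd [lin leib]]] kx; split.
  by move=> M kM; apply: kQ_sub; [exact: kD | apply: kQ_sub; exact: kQ_mul].
split.
  move=> M N kM kN IMN.
  have -> : D M - (x * M - M * x) - (D N - (x * N - N * x)) =
    D M - D N - (x * (M - N) - (M - N) * x) by mx3_ring.
  apply: (idealB hI); first exact: wd.
  by apply: (idealB hI); [exact: idealMl | exact: idealMr].
split=> [c M N kM kN | M N kM kN].
  have -> : D (c%:P *: M + N) - (x * (c%:P *: M + N) - (c%:P *: M + N) * x) -
    (c%:P *: (D M - (x * M - M * x)) + (D N - (x * N - N * x))) =
    D (c%:P *: M + N) - (c%:P *: D M + D N) by mx3_ring.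
  exact: lin.
have -> : D (M * N) - (x * (M * N) - M * N * x) -
  ((D M - (x * M - M * x)) * N + M * (D N - (x * N - N * x))) =
  D (M * N) - (D M * N + M * D N) by mx3_ring.
exact: leib.
Qed.

Lemma derivation_idem D : is_derivation I D ->
  exists2 x, kQ x & forall i, I (D (idem k i) - (x * idem k i - idem k i * x)).
Proof.
move=> hD; have [kD [wd [lin leib]]] := hD.
pose x := D (idem k v1) * idem k v1 + D (idem k v2) * idem k v2 + D (idem k v3) * idem k v3.
have ke i : kQ (idem k i) by exact: kQ_idem.
have kDe i : kQ (D (idem k i) * idem k i) by apply: kQ_mul => //; exact: kD.
have kx : kQ x by do 2 apply: kQ_add => //.
have eM i j : idem k i * idem k j = idem k i *+ (i == j).
  by rewrite !idem_unit unit_mxM mulr1; case: eqP => [->|].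
exists x => // j.
have xe : x * idem k j = D (idem k j) * idem k j.
  by rewrite /x !mulrDl -!mulrA !eM; case: (ord3P j) => ->;
    rewrite /= !(mulr1n, mulr0n, mulr0, addr0, add0r).
pose T i := D (idem k j * idem k i) - (D (idem k j) * idem k i + idem k j * D (idem k i)).
have IT i : I (T i * idem k i) by apply: (idealMr hI) => //; exact: leib.
have Ioff i : I ((D (idem k j * idem k i) - D (idem k j) *+ (i == j)) * idem k i).
  apply: (idealMr hI) => //; rewrite eM eq_sym; case: eqP => _; rewrite !(mulr1n, mulr0n).
    by rewrite subrr; apply: ideal0.
  by rewrite subr0; apply: derivation0.
have e1 : D (idem k j) = D (idem k j) * idem k v1 * idem k v1 +
    D (idem k j) * idem k v2 * idem k v2 + D (idem k j) * idem k v3 * idem k v3.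
  by rewrite -!mulrA !eM !eqxx -!mulrDr sum_idem mulr1.
have e2 : D (idem k j) * idem k j = D (idem k j) *+ (v1 == j) * idem k v1 +
    D (idem k j) *+ (v2 == j) * idem k v2 + D (idem k j) *+ (v3 == j) * idem k v3.
  by case: (ord3P j) => ->; rewrite /= !(mulr1n, mulr0n, mul0r, addr0, add0r).
rewrite xe {1}e1 e2 /x.
set S := (X in I X).
have -> : S = \sum_i ((D (idem k j * idem k i) - D (idem k j) *+ (i == j)) * idem k i
   - T i * idem k i).
  rewrite sum_ord3 /S /T; move: (D (idem k j) *+ (v1 == j)) (D (idem k j) *+ (v2 == j)).
  by move: (D (idem k j) *+ (v3 == j)) => *; mx3_ring.
have add_closed := big_ind I (ideal0 hI) (idealD hI).
by apply: (add_closed) => i _; apply: idealB.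
Qed.

(* A derivation killing the vertices is determined by its values on the arrows, which lie in
   the same corner [e_i Lambda e_j] as the arrow; the coboundary part [d] absorbs the values
   on [alpha] and [gamma]. *)
Lemma derivation_outer D : is_derivation I D -> (forall i, I (D (idem k i))) ->
  exists h d, d v1 = 0 /\ forall M, kQ M -> I (D M - outer_der h d M).
Proof.
move=> hD De; have [kD [wd [lin leib]]] := hD.
have [ka kb kc] := kQ_arrows k.
have corner i j M : kQ M -> idem k i * M = M -> M * idem k j = M ->
    I (D M - unit_mx i j (D M i j)).
  move=> kM eM Me; rewrite -idem_mul_idem.
  have l := leib _ _ (kQ_idem k i) kM; have r := leib _ _ kM (kQ_idem k j).
  rewrite eM in l; rewrite Me in r.
  have -> : D M - idem k i * D M * idem k j =
    (D M - (D M * idem k j + M * D (idem k j))) + M * D (idem k j) +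
    ((D M - (D (idem k i) * M + idem k i * D M)) * idem k j + D (idem k i) * M * idem k j).
    by mx3_ring.
  apply: (idealD hI); first by apply: (idealD hI) => //; apply: idealMl.
  apply: (idealD hI); apply: (idealMr hI) => //; try exact: kQ_idem.
  exact: idealMr.
pose f := D (alpha k) v1 v2; pose h := D (beta k) v2 v2; pose g := D (gamma k) v2 v3.
pose d (i : 'I_3) := if i == v1 then 0 else if i == v2 then f else f + g.
exists h, d; split=> // M; elim=> {M} [i|a| |M N kM IM kN IN|c M kM IM|M N kM IM kN IN].
- have -> : outer_der h d (idem k i) = 0.
    apply/matrixP => i' j; rewrite outer_derE idem_unit unit_mxE mxE -polyC1 -polyCMn derivC.
    by have [->|] := eqVneq i' i; have [->|] := eqVneq j i;
      rewrite /= ?subrr ?mulr0 ?mulr0n ?mul0r ?addr0.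
  by rewrite subr0.
- have: [\/ arrow k a = alpha k, arrow k a = beta k | arrow k a = gamma k].
    by case: (ord3P a) => ->; [constructor 1 | constructor 2 | constructor 3].
  case=> ->.
  + have -> : outer_der h d (alpha k) = unit_mx v1 v2 f.
      apply/matrixP => i j; rewrite outer_derE alpha_unit !unit_mxE -polyC1 -polyCMn derivC.
      by case: (ord3P i) => ->; case: (ord3P j) => ->;
        rewrite /d /= !(mulr0, mulr1n, mulr0n, mul0r, add0r, subr0, mul1r).
    by apply: corner => //; rewrite !kQ_unit unit_mxMM ?mul1r ?mulr1.
  + have -> : outer_der h d (beta k) = unit_mx v2 v2 h.
      apply/matrixP => i j; rewrite outer_derE beta_unit !unit_mxE derivMn derivX.
      by case: (ord3P i) => ->; case: (ord3P j) => ->;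
        rewrite /d /= !(mulr0, mulr1n, mulr0n, mul0r, addr0, subrr, mulr1).
    by apply: corner => //; rewrite !kQ_unit unit_mxMM ?mul1r ?mulr1.
  + have -> : outer_der h d (gamma k) = unit_mx v2 v3 g.
      apply/matrixP => i j; rewrite outer_derE gamma_unit !unit_mxE -polyC1 -polyCMn derivC.
      by case: (ord3P i) => ->; case: (ord3P j) => ->;
        rewrite /d /= !(mulr0, mulr1n, mulr0n, mul0r, add0r, mul1r) //; ring.
    by apply: corner => //; rewrite !kQ_unit unit_mxMM ?mul1r ?mulr1.
- have -> : outer_der h d 0 = 0.
    by apply/matrixP => i j; rewrite !mxE deriv0 mulr0 mul0r addr0.
  by rewrite subr0; apply: derivation0.
- have -> : D (M + N) - outer_der h d (M + N) = (D (1%:P *: M + N) - (1%:P *: D M + D N))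
     + (D M - outer_der h d M) + (D N - outer_der h d N).
    rewrite -[in outer_der h d (M + N)](scale1r M) -[1]/(1%:P) outer_der_linear.
    by rewrite polyC1 !scale1r; mx3_ring.
  apply: (idealD hI) => //; apply: (idealD hI) => //; exact: lin.
- have -> : D (c%:P *: M) - outer_der h d (c%:P *: M) =
     (D (c%:P *: M + 0) - (c%:P *: D M + D 0)) + D 0 + c%:P *: (D M - outer_der h d M)
     - outer_der h d 0.
    by rewrite -[in outer_der h d (_ *: _)](addr0 (c%:P *: M)) outer_der_linear addr0; mx3_ring.
  have o0 : outer_der h d 0 = 0.
    by apply/matrixP => i j; rewrite !mxE deriv0 mulr0 mul0r addr0.
  rewrite o0 subr0; apply: (idealD hI); last exact: idealZ.
  apply: (idealD hI); last exact: derivation0.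
  by apply: lin => //; exact: kQ_zero.
- have -> : D (M * N) - outer_der h d (M * N) = (D (M * N) - (D M * N + M * D N))
     + (D M - outer_der h d M) * N + M * (D N - outer_der h d N).
    by rewrite outer_der_mul; mx3_ring.
  apply: (idealD hI); last exact: idealMl.
  by apply: (idealD hI); [exact: leib | exact: idealMr].
Qed.

End Derivations.

Section RigidVanishing.
Variable k : fieldType.

Lemma rigid_ideal_HH1 : HH1_vanishes (@rigid_ideal k).
Proof.
have hI := rigid_ideal_is_ideal k.
move=> D hD; have [x kx Dx] := derivation_idem hI hD.
have hD' := derivation_sub_inner hI hD kx.
have [h [d [d1 Dh]]] := derivation_outer hI hD' Dx.
have stab M : rigid_ideal M -> rigid_ideal (outer_der h d M).
  move=> IM; have := Dh M (ideal_kQ hI IM); have := derivation_ideal hI hD' IM => /= IDM.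
  by move=> /(idealB hI IDM); rewrite subKr.
have [h8 g8] : 'X^8 %| h /\ 'X^8 %| d v3 - ((d v3)`_0)%:P.
  apply: rigid_spaceP.
    have [|_ _ + _ _] := stab (unit_mx v2 v2 'X^8).
      split; rewrite ?unit_mxE /= ?dvdp0 //; first exact: kQ_unit22.
      by apply: rigid_space_low; rewrite dvdp0.
    rewrite outer_derE unit_mxE !eqxx mulr1n subrr mulr0 addr0 derivXn => /dvdp_XnP/(_ 7 isT).
    by rewrite mulrnAr coefMn coefMXn /= subnn.
  move=> p Wp; have [|_ _ _ _] := stab (unit_mx v1 v3 p).
    by split; rewrite ?unit_mxE /= ?dvdp0 //; exact: kQ_unit13.
  by rewrite outer_derE unit_mxE !eqxx mulr1n d1 subr0.
pose c := (d v3)`_0.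
pose d' (i : 'I_3) := if i == v1 then 0 else if i == v2 then d v2 else c%:P.
have [y ky yE] : exists2 y, kQ y &
    forall M i j, (y * M - M * y) i j = M i j * (d' j - d' i).
  exists (- (unit_mx v2 v2 (d v2) + unit_mx v3 v3 c%:P)).
    by apply: kQ_opp; apply: kQ_add; [exact: kQ_unit22 | exact: kQ_unitC].
  move=> M i j; rewrite entryB !mulmx3E !(entryN, entryD, unit_mxE) /d'.
  move: (d v2) c%:P (M) => d2 c' {}M.
  by case: (ord3P i) => ->; case: (ord3P j) => ->; rewrite /= !(mulr1n, mulr0n); ring.
exists (x + y); split; first exact: kQ_add.
move=> M kM.
have -> : D M - ((x + y) * M - M * (x + y)) =
  (D M - (x * M - M * x) - outer_der h d M) + (outer_der h d M - (y * M - M * y)).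
  rewrite subrKA mulrDl mulrDr; move: (x * M) (y * M) (M * x) (M * y) (D M) => *.
  by apply/matrixP => i j; rewrite ?(entryD, entryN); ring.
apply: (idealD hI); first exact: Dh.
have hp p : 'X^8 %| h * p by apply: dvdp_mulr.
have gp p : 'X^8 %| p * (d v3 - c%:P) by apply: dvdp_mull.
have [[e1 e2 e3] [c1 [c3 [f1 f3]]]] := kQ_shapeP kM.
have eE i j : (outer_der h d M - (y * M - M * y)) i j =
    h * (M i j)^`() + M i j * (d j - d i - (d' j - d' i)).
  by rewrite entryB yE outer_derE -addrA -mulrBr.
split; rewrite ?eE /d' /= ?d1.
- by apply: kQ_sub; [exact: outer_der_kQ | apply: kQ_sub; exact: kQ_mul].
- by rewrite f1 f3 !derivC !subrr !mulr0 !addr0.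
- by rewrite !subrr mulr0 addr0; apply: hp.
- split; first by rewrite !subr0 subrr mulr0 addr0; apply: hp.
  rewrite (_ : d v3 - d v2 - (c%:P - d v2) = d v3 - c%:P); last by ring.
  exact: dvdp_add.
- by apply: rigid_space_low; rewrite !subr0; apply: dvdp_add.
Qed.

End RigidVanishing.

(** * Modules and global dimension *)

Section Eval.
Variables (k : fieldType) (d : nat) (B : 'M[k]_d).
Implicit Types (p q : {poly k}).

(* [horner_mx] is only available in positive dimension. *)
Definition mx_eval p : 'M[k]_d := \sum_(i < size p) p`_i *: B ^+ i.

Lemma mx_eval_wide m p : (size p <= m)%N -> mx_eval p = \sum_(i < m) p`_i *: B ^+ i.
Proof.
move=> le_pm; rewrite /mx_eval (big_ord_widen _ (fun i => p`_i *: B ^+ i) le_pm) big_mkcond.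
by apply: eq_bigr => i _; case: ltnP => // le_pi; rewrite nth_default // scale0r.
Qed.

Lemma mx_evalD p q : mx_eval (p + q) = mx_eval p + mx_eval q.
Proof.
rewrite (@mx_eval_wide (maxn (size p) (size q)) (p + q)) ?size_polyD //.
rewrite (mx_eval_wide (leq_maxl (size p) (size q))) (mx_eval_wide (leq_maxr (size p) (size q))).
by rewrite -big_split; apply: eq_bigr => i _; rewrite coefD scalerDl.
Qed.

Lemma mx_evalZ c p : mx_eval (c *: p) = c *: mx_eval p.
Proof.
rewrite (@mx_eval_wide (size p)) ?size_scale_leq // scaler_sumr.
by apply: eq_bigr => i _; rewrite coefZ scalerA.
Qed.

Lemma mx_eval0 : mx_eval 0 = 0. Proof. by rewrite /mx_eval size_poly0 big_ord0. Qed.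

Lemma mx_evalMX p : mx_eval (p * 'X) = mx_eval p *m B.
Proof.
rewrite (@mx_eval_wide (size p).+1) ?size_mulX_leq //; last first.
  by rewrite (leq_trans (size_polyMleq _ _)) // size_polyX addn2.
rewrite big_ord_recl coefMX /= scale0r add0r mulmx_suml; apply: eq_bigr => i _.
by rewrite coefMX /= -scalemxAl exprSr.
Qed.

Lemma mx_evalC c : mx_eval c%:P = c%:M.
Proof.
rewrite (@mx_eval_wide 1) ?size_polyC_leq1 // big_ord1 coefC /= expr0 -scalemx1.
by [].
Qed.

Lemma mx_evalM p q : mx_eval (p * q) = mx_eval p *m mx_eval q.
Proof.
elim/poly_ind: q => [|q c IHq]; first by rewrite mulr0 mx_eval0 mulmx0.
rewrite mulrDr mulrA !mx_evalD !mx_evalMX IHq mulmxDr mulmxA; congr (_ + _).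
by rewrite mulrC mul_polyC mx_evalZ mx_evalC mul_mx_scalar.
Qed.

Lemma mx_eval1 : mx_eval 1 = 1%:M. Proof. exact: mx_evalC. Qed.

Lemma mx_evalXn m : mx_eval 'X^m = B ^+ m.
Proof. by elim: m => [|m IHm]; rewrite ?expr0 ?mx_eval1 // !exprSr mx_evalMX IHm. Qed.

Lemma mx_evalX : mx_eval 'X = B. Proof. exact: (mx_evalXn 1). Qed.

End Eval.

Section Modules.
Variable k : fieldType.
Implicit Types (V W P : rep k).

(* The representation of the quiver vanishing at vertex 1, with loop [B] and arrow [C]. *)
Definition rep23 (d2 d3 : nat) (B : 'M[k]_d2) (C : 'M[k]_(d2, d3)) : rep k :=
  @Rep k (d2 + d3) (fun M => block_mx (mx_eval B (M v2 v2)) (mx_eval B (M v2 v3) *m C)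
                                       0 ((M v3 v3)`_0)%:M).

Lemma rep23_is_mod I a b n (d2 d3 : nat) (B : 'M[k]_d2) (C : 'M[k]_(d2, d3)) :
  is_ideal I -> exponents I a b n -> B ^+ n = 0 -> B ^+ b *m C = 0 -> is_mod I (rep23 B C).
Proof.
move=> hI hexp Bn BbC; split.
  move=> M N /kQ_shapeP[[M21 M31 M32] [? [? [_ M33]]]] /kQ_shapeP[[N21 N31 N32] [? [? [_ N33]]]].
  rewrite /= !mulmx3E M21 M31 M32 N32 !mul0r !mulr0 !addr0 !add0r.
  rewrite mulmx_block !(mul0mx, mulmx0, addr0, add0r) M33 N33 -polyCM !coefC /= -scalar_mxM.
  rewrite mx_evalM mx_evalD mx_evalM [_ * _%:P]mulrC mul_polyC mx_evalZ mulmxDl.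
  by rewrite mul_mx_scalar -scalemxAl mulmxA.
split.
  by rewrite /= !mxE /= mx_eval1 coef1 /= mx_eval0 mul0mx -scalar_mx_block.
split.
  move=> c M N _ _.
  rewrite /= !mxE scale_block_mx add_block_mx !mul_polyC !mx_evalD !mx_evalZ scaler0 addr0.
  by rewrite mulmxDl -scalemxAl coefD coefZ raddfD /= scale_scalar_mx.
move=> M IM; have [_ M33] := exp_diag hexp IM.
have /(exp_22 hexp)/dvdpP[p22 e22] := ideal_entry hI v2 v2 IM.
have /(exp_23 hexp)/dvdpP[p23 e23] := ideal_entry hI v2 v3 IM.
rewrite /= M33 e22 e23 !mx_evalM !mx_evalXn Bn mulmx0 -mulmxA BbC mulmx0 coef0.
by rewrite /block_mx !(row_mx0, raddf0) col_mx0.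
Qed.

Lemma is_mod_mul I V M N : is_mod I V -> kQ M -> kQ N ->
  ract V (M * N) = ract V M *m ract V N.
Proof. by case=> h _; apply: h. Qed.

Lemma is_mod0 I V : is_mod I V -> ract V 0 = 0.
Proof.
move=> [_ [_ [lin _]]]; have := lin 1 0 0 (kQ_zero k) (kQ_zero k).
by rewrite scaler0 addr0 scale1r => /esym/eqP; rewrite -subr_eq0 addrK => /eqP.
Qed.

Lemma is_modZ I V (c : k) M : is_mod I V -> kQ M -> ract V (c%:P *: M) = c *: ract V M.
Proof.
move=> hV kM; rewrite -[c%:P *: M]addr0 (hV.2.2.1 c M 0 kM (kQ_zero k)).
by rewrite (is_mod0 hV) addr0.
Qed.

Lemma is_modD I V M N : is_mod I V -> kQ M -> kQ N -> ract V (M + N) = ract V M + ract V N.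
Proof. by move=> hV kM kN; rewrite -[M]scale1r (hV.2.2.1 1 M N kM kN) !scale1r. Qed.

Lemma is_hom_gen I V W (F : 'M[k]_(rdim W, rdim V)) : is_mod I V -> is_mod I W ->
  (forall i, F *m ract V (idem k i) = ract W (idem k i) *m F) ->
  (forall a, F *m ract V (arrow k a) = ract W (arrow k a) *m F) -> is_hom F.
Proof.
move=> hV hW Fe Fa M; elim=> {M} // [|M N kM hM kN hN|c M kM hM|M N kM hM kN hN].
- by rewrite (is_mod0 hV) (is_mod0 hW) mulmx0 mul0mx.
- by rewrite (is_modD hV) // (is_modD hW) // mulmxDr mulmxDl hM hN.
- by rewrite (is_modZ _ hV) // (is_modZ _ hW) // -scalemxAr -scalemxAl hM.
- by rewrite (is_mod_mul hV) // (is_mod_mul hW) // mulmxA hM -mulmxA hN mulmxA.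
Qed.

Lemma rep23_gens (d2 d3 : nat) (B : 'M[k]_d2) (C : 'M[k]_(d2, d3)) (V := rep23 B C) :
  ((ract V (idem k v1) = 0) * (ract V (idem k v2) = block_mx 1%:M 0 0 0) *
   (ract V (idem k v3) = block_mx 0 0 0 1%:M) * (ract V (alpha k) = 0) *
   (ract V (beta k) = block_mx B 0 0 0) * (ract V (gamma k) = block_mx 0 C 0 0))%type.
Proof.
have z : (0 : 'M[k]_(d2 + d3)) = block_mx 0 0 0 0 by rewrite block_mx_const.
do !split; rewrite /V /= !kQ_unit !unit_mxE /= !(mulr1n, mulr0n) ?z;
  by rewrite ?mx_eval0 ?mx_eval1 ?mx_evalX ?coef0 ?coef1 ?mul0mx ?mul1mx ?raddf0.
Qed.

Lemma hom_to_rep23 I V (d2 d3 : nat) (B : 'M[k]_d2) (C : 'M[k]_(d2, d3))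
    (F2 : 'M[k]_(d2, rdim V)) (F3 : 'M[k]_(d3, rdim V)) :
  is_mod I V -> is_mod I (rep23 B C) ->
  is_hom (V := V) (W := rep23 B C) (col_mx F2 F3) <->
  [/\ F2 *m ract V (idem k v2) = F2, F3 *m ract V (idem k v3) = F3,
      F2 *m ract V (beta k) = B *m F2 & F2 *m ract V (gamma k) = C *m F3].
Proof.
move=> hV hW; have [[[[[ge1 ge2] ge3] ga] gb] gc] := rep23_gens B C.
have [ka kb kc] := kQ_arrows k.
have comp (X : Mx k) X1 X2 X3 X4 : ract (rep23 B C) X = block_mx X1 X2 X3 X4 ->
    ract (rep23 B C) X *m col_mx F2 F3 = col_mx (X1 *m F2 + X2 *m F3) (X3 *m F2 + X4 *m F3).
  by move=> ->; rewrite mul_block_col.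
split=> [hF | [F2e F3e F2b F2c]].
  split.
  - have := hF _ (kQ_idem k v2); rewrite mul_col_mx (comp _ _ _ _ _ ge2).
    by rewrite mul1mx !mul0mx !addr0 => /eq_col_mx[].
  - have := hF _ (kQ_idem k v3); rewrite mul_col_mx (comp _ _ _ _ _ ge3).
    by rewrite mul1mx !mul0mx !add0r => /eq_col_mx[].
  - have := hF _ kb; rewrite mul_col_mx (comp _ _ _ _ _ gb).
    by rewrite !mul0mx !addr0 => /eq_col_mx[].
  - have := hF _ kc; rewrite mul_col_mx (comp _ _ _ _ _ gc).
    by rewrite !mul0mx !add0r => /eq_col_mx[].
have F2z M : kQ M -> idem k v2 * M = 0 -> F2 *m ract V M = 0.
  by move=> kM eM; rewrite -F2e -mulmxA -(is_mod_mul hV) ?eM ?(is_mod0 hV) ?mulmx0 //; constructor.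
have F3z M : kQ M -> idem k v3 * M = 0 -> F3 *m ract V M = 0.
  by move=> kM eM; rewrite -F3e -mulmxA -(is_mod_mul hV) ?eM ?(is_mod0 hV) ?mulmx0 //; constructor.
apply: (is_hom_gen hV hW) => [i | a]; rewrite mul_col_mx.
  case: (ord3P i) => ->.
  - rewrite ge1 mul0mx F2z ?F3z ?col_mx0 //;
      by [exact: kQ_idem | rewrite !idem_unit unit_mxM].
  - rewrite (comp _ _ _ _ _ ge2) mul1mx !mul0mx !addr0 F2e F3z //;
      by [exact: kQ_idem | rewrite !idem_unit unit_mxM].
  - rewrite (comp _ _ _ _ _ ge3) mul1mx !mul0mx !add0r F3e F2z //;
      by [exact: kQ_idem | rewrite !idem_unit unit_mxM].
case: (ord3P a) => ->.
- rewrite -[arrow k v1]/(alpha k).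
  by rewrite ga mul0mx F2z ?F3z ?col_mx0 //; rewrite !kQ_unit unit_mxM.
- rewrite -[arrow k v2]/(beta k) (comp _ _ _ _ _ gb) !mul0mx !addr0 F2b F3z //.
  by rewrite idem_unit beta_unit unit_mxM.
- rewrite -[arrow k v3]/(gamma k) (comp _ _ _ _ _ gc) !mul0mx !add0r F2c F3z //.
  by rewrite !kQ_unit unit_mxM.
Qed.

Definition shift_mx d : 'M[k]_d := \matrix_(i, j) ((i == j.+1 :> nat)%:R).

Lemma shift_mxX d m i j : (shift_mx d ^+ m) i j = (i == j + m :> nat)%N%:R.
Proof.
elim: m i j => [|m IHm] i j; first by rewrite expr0 mxE addn0.
rewrite exprSr mxE; case: (ltnP j.+1 d) => lt_j.
  rewrite (bigD1 (Ordinal lt_j)) //= big1 => [|l ne_l].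
    by rewrite addr0 IHm !mxE /= eqxx mulr1 addSnnS.
  rewrite !mxE (_ : (l == j.+1 :> nat) = false) ?mulr0 //.
  by apply: contraNF ne_l => /eqP e; apply/eqP/val_inj.
rewrite big1 => [|l _].
  by rewrite (_ : (_ == _) = false) //; have := ltn_ord i; lia.
by rewrite !mxE (_ : (l == j.+1 :> nat) = false) ?mulr0 //; have := ltn_ord l; lia.
Qed.

Lemma shift_mx_nilpotent d m : (d <= m)%N -> shift_mx d ^+ m = 0.
Proof.
move=> le_dm; apply/matrixP => i j; rewrite shift_mxX mxE.
by rewrite (_ : (_ == _) = false) //; have := ltn_ord i; lia.
Qed.

Lemma mulmx1_rank m p (X : 'M[k]_(m, p)) (Y : 'M[k]_(p, m)) : X *m Y = 1%:M -> \rank X = m.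
Proof. by move=> XY; apply/eqP/row_freeP; exists Y. Qed.

Lemma hom_rep23 I (d2 d3 e2 e3 : nat) (B : 'M[k]_d2) (C : 'M[k]_(d2, d3))
    (B' : 'M[k]_e2) (C' : 'M[k]_(e2, e3)) (F2 : 'M[k]_(e2, d2)) (F3 : 'M[k]_(e3, d3)) :
  is_mod I (rep23 B C) -> is_mod I (rep23 B' C') ->
  F2 *m B = B' *m F2 -> F2 *m C = C' *m F3 ->
  is_hom (V := rep23 B C) (W := rep23 B' C') (block_mx F2 0 0 F3).
Proof.
move=> hV hW FB FC; have [[[[[ge1 ge2] ge3] ga] gb] gc] := rep23_gens B C.
rewrite /block_mx; apply/(hom_to_rep23 _ _ hV hW); rewrite ge2 ge3 gb gc !mul_row_block.
by rewrite !(mulmx0, mul0mx, mulmx1, addr0, add0r) !mul_mx_row !mulmx0 FB FC.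
Qed.

Lemma block_diag_rank (d2 d3 e2 e3 : nat) (F2 : 'M[k]_(e2, d2)) (F3 : 'M[k]_(e3, d3))
    (G2 : 'M[k]_(d2, e2)) (G3 : 'M[k]_(d3, e3)) :
  F2 *m G2 = 1%:M -> F3 *m G3 = 1%:M -> \rank (block_mx F2 0 0 F3) = (e2 + e3)%N.
Proof.
move=> FG2 FG3; apply: (@mulmx1_rank _ _ _ (block_mx G2 0 0 G3)).
by rewrite mulmx_block !(mulmx0, mul0mx, addr0, add0r) FG2 FG3 -scalar_mx_block.
Qed.

End Modules.

Section Projectives.
Variables (k : fieldType) (I : Mx k -> Prop) (a b n : nat).
Hypotheses (hI : is_ideal I) (hexp : exponents I a b n).
Variable P : rep k.
Hypotheses (hP : is_mod I P) (projP : projective I P).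
Let E2 := ract P (idem k v2).
Let E3 := ract P (idem k v3).
Let Bt := ract P (beta k).
Let Gm := ract P (gamma k).

Let mulE M N L : kQ M -> kQ N -> M * N = L -> ract P M *m ract P N = ract P L.
Proof. by move=> kM kN <-; rewrite (is_mod_mul hP). Qed.

Let kb : kQ (beta k). Proof. by have [] := kQ_arrows k. Qed.
Let kc : kQ (gamma k). Proof. by have [] := kQ_arrows k. Qed.

Let E2E2 : E2 *m E2 = E2.
Proof. by apply: mulE; try constructor; rewrite !kQ_unit unit_mxMM mulr1. Qed.
Let E3E3 : E3 *m E3 = E3.
Proof. by apply: mulE; try constructor; rewrite !kQ_unit unit_mxMM mulr1. Qed.
Let BtE2 : Bt *m E2 = Bt.
Proof. by apply: mulE => //; try constructor; rewrite !kQ_unit unit_mxMM mulr1. Qed.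
Let GmE3 : Gm *m E3 = Gm.
Proof. by apply: mulE => //; try constructor; rewrite !kQ_unit unit_mxMM mulr1. Qed.

Let Bt_exp m : Bt ^+ m.+1 = ract P (unit_mx v2 v2 'X^(m.+1)).
Proof.
elim: m => [|m IHm]; first by rewrite expr1.
by rewrite exprS IHm; apply: mulE => //; [exact: kQ_unit22 | rewrite beta_unit unit_mxMM -exprS].
Qed.

Let Bt_nilp : Bt ^+ n = 0.
Proof.
have := exp_n_ge2 hexp; case: (n) (exp_22 hexp) => // m e22 _; rewrite Bt_exp.
by apply: hP.2.2.2; apply/e22.
Qed.

Let BtGm_nilp : Bt ^+ b *m Gm = 0.
Proof.
have := exp_b_gt0 hexp; case: (b) (exp_23 hexp) => // m e23 _; rewrite Bt_exp.
rewrite (mulE (L := unit_mx v2 v3 'X^(m.+1))) //; last by rewrite gamma_unit unit_mxMM mulr1.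
  by apply: hP.2.2.2; apply/e23.
exact: kQ_unit22.
Qed.

(* Lift [u : P -> S_2] to the regular module of [k[X]/X^n] placed at vertex 2. *)
Lemma projective_lift2 (u : 'rV_(rdim P)) :
  u *m E2 = u -> u *m Bt = 0 -> u *m Gm = 0 ->
  exists v, [/\ v *m E2 = v, v *m Bt ^+ n.-1 = u & forall i, v *m Bt ^+ i *m Gm = 0].
Proof.
move=> uE uB uG; have n2 := exp_n_ge2 hexp.
have n0 : (0 < n)%N by lia. have n1 : (n.-1 < n)%N by lia.
pose A := rep23 (shift_mx k n) (0 : 'M_(n, 0)).
pose S2 := rep23 (0 : 'M[k]_1) (0 : 'M_(1, 0)).
have hA : is_mod I A by apply: (rep23_is_mod hI hexp); rewrite ?mulmx0 // shift_mx_nilpotent.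
have hS : is_mod I S2 by apply: (rep23_is_mod hI hexp); rewrite ?mulmx0 // expr0n; case: (n) n0.
pose i0 := Ordinal n0; pose i1 := Ordinal n1.
pose g2 : 'M[k]_(1, n) := delta_mx 0 i0.
have g2S : g2 *m shift_mx k n = 0.
  by rewrite -rowE; apply/rowP => j; rewrite !mxE.
have hg : is_hom (V := A) (W := S2) (block_mx g2 0 0 (0 : 'M_(0, 0))).
  by apply: (hom_rep23 hA hS); rewrite ?g2S ?mul0mx ?mulmx0.
have rg : \rank (block_mx g2 0 0 (0 : 'M[k]_(0, 0))) = (1 + 0)%N.
  apply: (@block_diag_rank _ _ _ _ _ _ _ (delta_mx i0 0) 0); last first.
    by rewrite [LHS]flatmx0 [RHS]flatmx0.
  by rewrite mul_delta_mx; apply/rowP => j; rewrite !ord1 !mxE.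
have hu : is_hom (V := P) (W := S2) (col_mx u 0).
  by apply/(hom_to_rep23 _ _ hP hS); split=> //; rewrite ?mul0mx.
have [H [hH gH]] := projP hA hS hg rg hu.
rewrite -[H](@vsubmxK _ n 0) in hH gH; move: (usubmx _) (dsubmx _) hH gH => H2 H3 hH.
rewrite mul_block_col => /eq_col_mx[+ _]; rewrite mul0mx addr0 => eu.
have [HE2 _ HB HG] := (hom_to_rep23 _ _ hP hA).1 hH.
have HBm m : H2 *m Bt ^+ m = shift_mx k n ^+ m *m H2.
  elim: m => [|m IHm]; first by rewrite !expr0 mulmx1 mul1mx.
  by rewrite !exprSr mulmxA IHm -mulmxA HB mulmxA.
exists (delta_mx 0 i1 *m H2); split.
- by rewrite -mulmxA HE2.
- rewrite -mulmxA HBm -eu mulmxA; congr (_ *m _).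
  rewrite -rowE; apply/rowP => j; rewrite mxE shift_mxX mxE eqxx /=.
  by congr ((nat_of_bool _)%:R); apply/eqP/eqP => [e|->] //; apply: val_inj => /=; lia.
- by move=> m; rewrite -(mulmxA _ H2) HBm -!mulmxA HG mul0mx !mulmx0.
Qed.

(* Lift [w : P -> S_3] to the column module [Lambda e_3 / e_1 Lambda e_3]. *)
Lemma projective_lift3 (w : 'rV_(rdim P)) j : w *m E3 = w -> (j < b)%N ->
  exists u, [/\ u *m E2 = u, u *m Bt ^+ j *m Gm = w &
    forall i, i != j -> u *m Bt ^+ i *m Gm = 0].
Proof.
move=> wE ltj; have n2 := exp_n_ge2 hexp; have b0 := exp_b_gt0 hexp; have bn := exp_b_le hexp.
pose Y := rep23 (shift_mx k b) (delta_mx (Ordinal b0) 0 : 'M_(b, 1)).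
pose S3 := rep23 (0 : 'M[k]_0) (0 : 'M_(0, 1)).
have hY : is_mod I Y.
  by apply: (rep23_is_mod hI hexp); rewrite shift_mx_nilpotent // mul0mx.
have hS : is_mod I S3 by apply: (rep23_is_mod hI hexp); rewrite ?mulmx0 // flatmx0.
have hg : is_hom (V := Y) (W := S3) (block_mx 0 0 0 (1%:M : 'M_1)).
  by apply: (hom_rep23 hY hS); rewrite ?mul0mx.
have rg : \rank (block_mx (0 : 'M[k]_(0, b)) 0 0 (1%:M : 'M[k]_1)) = (0 + 1)%N.
  by apply: (@block_diag_rank _ _ _ _ _ _ _ 0 1%:M); rewrite ?mulmx1 // [RHS]flatmx0 mul0mx.
have hw : is_hom (V := P) (W := S3) (col_mx 0 w).
  by apply/(hom_to_rep23 _ _ hP hS); split=> //; rewrite ?mul0mx.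
have [H [hH gH]] := projP hY hS hg rg hw.
rewrite -[H](@vsubmxK _ b 1) in hH gH; move: (usubmx _) (dsubmx _) hH gH => H2 H3 hH.
rewrite mul_block_col => /eq_col_mx[_]; rewrite mul0mx add0r mul1mx => ew.
have [HE2 _ HB HG] := (hom_to_rep23 _ _ hP hY).1 hH.
have HBm m : H2 *m Bt ^+ m = shift_mx k b ^+ m *m H2.
  elim: m => [|m IHm]; first by rewrite !expr0 mulmx1 mul1mx.
  by rewrite !exprSr mulmxA IHm -mulmxA HB mulmxA.
have val m : delta_mx 0 (Ordinal ltj) *m H2 *m Bt ^+ m *m Gm = (j == m)%:R *: w.
  rewrite -(mulmxA _ H2) HBm -!mulmxA HG ew !mulmxA -rowE -colE -mul_scalar_mx.
  by congr (_ *m _); apply/rowP => i; rewrite !ord1 !mxE shift_mxX.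
exists (delta_mx 0 (Ordinal ltj) *m H2); split.
- by rewrite -mulmxA HE2.
- by rewrite val eqxx scale1r.
- by move=> i /negPf ne; rewrite val eq_sym ne scale0r.
Qed.

Let R := fix R t : 'M[k]_(rdim P) :=
  if t is t'.+1 then (R t' :&: kermx (Bt ^+ (b - t'.+1) *m Gm))%MS else E2.

Lemma sub_idem (E : 'M[k]_(rdim P)) m (u : 'M_(m, _)) : E *m E = E -> (u <= E)%MS -> u *m E = u.
Proof. by move=> EE /submxP[v ->]; rewrite -mulmxA EE. Qed.

Lemma sub_RP t (u : 'rV_(rdim P)) : (t <= b)%N ->
  (u <= R t)%MS <-> u *m E2 = u /\ forall i, (b - t <= i < b)%N -> u *m Bt ^+ i *m Gm = 0.
Proof.
elim: t => [|t IHt] ltb.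
  split=> [uE | [uE _]]; last by rewrite -uE submxMl.
  by split=> [|i]; [exact: sub_idem uE | lia].
rewrite /= sub_capmx; split.
  case/andP=> /(IHt (ltnW ltb))[uE ui] /sub_kermxP; rewrite mulmxA => ub; split=> // i lti.
  have [->//|ne] := eqVneq i (b - t.+1)%N.
  by apply: ui; lia.
case=> uE ui; apply/andP; split.
  by apply/(IHt (ltnW ltb)); split=> // i lti; apply: ui; lia.
by apply/sub_kermxP; rewrite mulmxA; apply: ui; lia.
Qed.

Lemma rank_R t : (t <= b)%N -> \rank E2 = (t * \rank E3 + \rank (R t))%N.
Proof.
elim: t => [//|t IHt] ltb; rewrite IHt 1?ltnW //.
rewrite -(mxrank_mul_ker (R t) (Bt ^+ (b - t.+1) *m Gm)) mulSn addnCA addnA.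
congr (_ + _ + _)%N; apply: eqmx_rank; apply/andP; split.
  by rewrite -GmE3 !mulmxA submxMl.
apply/row_subP => i.
have [u [uE uj ui]] : exists u, [/\ u *m E2 = u, u *m Bt ^+ (b - t.+1) *m Gm = row i E3 &
    forall l, l != (b - t.+1)%N -> u *m Bt ^+ l *m Gm = 0].
  by apply: projective_lift3; [rewrite -row_mul E3E3 | lia].
rewrite -uj -mulmxA submxMr //; apply/(sub_RP _ (ltnW ltb)); split=> // l lel.
by apply: ui; lia.
Qed.

Lemma rank_free (X : 'M[k]_(rdim P)) : stablemx X Bt ->
  (forall u : 'rV_(rdim P), (u <= X)%MS -> u *m Bt = 0 ->
     exists2 v : 'rV_(rdim P), (v <= X)%MS & v *m Bt ^+ n.-1 = u) ->
  (n %| \rank X)%N.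
Proof.
move=> stab lift; set r := \rank (X :&: kermx Bt)%MS.
have stabm m : (X *m Bt ^+ m <= X)%MS.
  elim: m => [|m IHm]; first by rewrite expr0 mulmx1.
  by rewrite exprSr mulmxA (submx_trans (submxMr _ IHm)).
have step m : (m <= n)%N -> \rank X = (m * r + \rank (X *m Bt ^+ m))%N.
  elim: m => [|m IHm] ltm; first by rewrite expr0 mulmx1.
  have -> : X *m Bt ^+ m.+1 = X *m Bt ^+ m *m Bt by rewrite exprSr mulmxA.
  rewrite IHm 1?ltnW // -(mxrank_mul_ker (X *m Bt ^+ m) Bt) mulSn.
  rewrite (_ : \rank (_ :&: _) = r); first by lia.
  apply: eqmx_rank; apply/andP; split; first by rewrite capmxS.
  apply/row_subP => i; move: (row_sub i (X :&: kermx Bt)%MS); rewrite !sub_capmx.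
  case/andP=> uX uB; rewrite uB andbT.
  have [v vX <-] := lift _ uX (sub_kermxP uB).
  have -> : n.-1 = (n.-1 - m + m)%N by lia.
  by rewrite exprD mulmxA submxMr // (submx_trans (submxMr _ vX)).
by rewrite (step n) // Bt_nilp mulmx0 mxrank0 addn0 dvdn_mulr.
Qed.

Lemma projective_rank : \rank E2 = (b * \rank E3)%N %[mod n].
Proof.
rewrite (rank_R (leqnn b)); apply/eqP; rewrite -[X in _ == X %[mod _]]addn0 eqn_modDl.
rewrite mod0n; apply: rank_free.
  apply/row_subP => i; rewrite row_mul.
  have /(sub_RP _ (leqnn b))[uE ui] := row_sub i (R b).
  apply/(sub_RP _ (leqnn b)); split; first by rewrite -mulmxA BtE2.
  move=> l; rewrite subnn /= => ltl; rewrite -(mulmxA _ Bt) -[Bt *m _]exprS.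
  have [e|ne] := eqVneq l.+1 b; first by rewrite e -mulmxA BtGm_nilp mulmx0.
  by apply: ui; lia.
move=> u /(sub_RP _ (leqnn b))[uE ui] uB.
have b0 := exp_b_gt0 hexp.
have uG : u *m Gm = 0 by have := ui 0; rewrite expr0 mulmx1; apply; lia.
have [v [vE vu vi]] := projective_lift2 uE uB uG.
by exists v => //; apply/(sub_RP _ (leqnn b)); split.
Qed.

End Projectives.

Section GlobalDimension.
Variables (k : fieldType) (I : Mx k -> Prop) (a b n : nat).
Hypotheses (hI : is_ideal I) (hexp : exponents I a b n).

Lemma idem_rank_additive (V P K : rep k) (p : 'M[k]_(rdim V, rdim P))
    (i : 'M[k]_(rdim P, rdim K)) e :
  is_mod I V -> is_mod I P -> is_mod I K -> is_hom p -> is_hom i ->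
  \rank p = rdim V -> \rank i = rdim K -> p *m i = 0 -> (\rank i + \rank p)%N = rdim P ->
  \rank (ract P (idem k e)) = (\rank (ract K (idem k e)) + \rank (ract V (idem k e)))%N.
Proof.
move=> hV hP hK hp hi rp ri pi0 rip.
have idemE (W : rep k) : is_mod I W -> ract W (idem k e) *m ract W (idem k e) = ract W (idem k e).
  by move=> hW; rewrite -(is_mod_mul hW) ?idem_unit ?unit_mxMM ?mulr1 //; exact: kQ_unitC.
have compl (W : rep k) : is_mod I W ->
    (\rank (ract W (idem k e)) + \rank (1%:M - ract W (idem k e))%R)%N = rdim W.
  move=> hW; move: (idemE W hW); move: (ract W _) => E EE.
  have := mxrank_mul_ker 1%:M E; rewrite mul1mx mxrank1 => e1; apply: etrans e1; congr (_ + _)%N.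
  apply: eqmx_rank; apply/andP; split.
    rewrite sub_capmx submx1; apply/sub_kermxP.
    by rewrite mulmxBl mul1mx EE subrr.
  apply/row_subP => l; have := row_sub l (1%:M :&: kermx E)%MS.
  rewrite sub_capmx => /andP[_ /sub_kermxP uE].
  by apply/submxP; exists (row l (1%:M :&: kermx E)%MS); rewrite mulmxBr mulmx1 uE subr0.
have frob (EV : 'M_(rdim V)) (EP : 'M_(rdim P)) (EK : 'M_(rdim K)) :
    p *m EP = EV *m p -> EP *m i = i *m EK -> (\rank EV + \rank EK <= \rank EP)%N.
  move=> ep ei; have := mxrank_Frobenius p EP i.
  rewrite -mulmxA ei mulmxA pi0 mul0mx mxrank0 addn0 ep.
  rewrite (mxrankMfree EV); last by apply/eqP.
  by rewrite -[\rank (i *m EK)]mxrank_tr trmx_mul mxrankMfree ?mxrank_tr // /row_free mxrank_tr ri.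
have ke := kQ_idem k e.
have f1 := frob _ _ _ (hp _ ke) (esym (hi _ ke)).
have f2 : (\rank (1%:M - ract V (idem k e))%R + \rank (1%:M - ract K (idem k e))%R <=
           \rank (1%:M - ract P (idem k e))%R)%N.
  apply: frob; first by rewrite mulmxBr mulmxBl mulmx1 mul1mx hp.
  by rewrite mulmxBr mulmxBl mulmx1 mul1mx hi.
have := compl _ hV; have := compl _ hP; have := compl _ hK; lia.
Qed.

Lemma pd_le_rank m V : is_mod I V -> pd_le I m V ->
  \rank (ract V (idem k v2)) = (b * \rank (ract V (idem k v3)))%N %[mod n].
Proof.
elim: m V => [|m IHm] V hV; first exact: (projective_rank hI hexp hV).
case=> P [K [p [i [hP [projP [hK [pdK [hp [hi [rp [ri [pi0 rip]]]]]]]]]]]].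
have add e := idem_rank_additive e hV hP hK hp hi rp ri pi0 rip.
have := projective_rank hI hexp hP projP; rewrite !add mulnDr.
rewrite -modnDml (IHm K hK pdK) modnDml => /eqP; rewrite eqn_modDl => /eqP.
by [].
Qed.

Lemma infinite_gldim_exponents : infinite_gldim I.
Proof.
move=> m; have n2 := exp_n_ge2 hexp.
pose S2 := rep23 (0 : 'M[k]_1) (0 : 'M_(1, 0)).
have hS : is_mod I S2.
  by apply: (rep23_is_mod hI hexp); rewrite ?mulmx0 // expr0n; case: (n) n2.
exists S2; split=> // /(pd_le_rank hS).
have [[[[[_ ->] ->] _] _] _] := rep23_gens (0 : 'M[k]_1) (0 : 'M_(1, 0)).
rewrite (_ : \rank (block_mx 0 _ _ _) = 0%N); last first.
  by rewrite [1%:M]flatmx0 block_mx_const mxrank0.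
rewrite (_ : \rank _ = 1%N); first by rewrite muln0 mod0n modn_small.
rewrite -[RHS]addn0.
by apply: (@block_diag_rank _ _ _ _ _ _ _ 1%:M 0); rewrite ?mulmx1 // [RHS]flatmx0 mul0mx.
Qed.

End GlobalDimension.

(** * Indecomposable modules *)

Section Family.
Variable k : fieldType.

Lemma shift_commuting_fix s (q : 'M[k]_s.+1) (J := shift_mx k s.+1) :
  q *m q = q -> q *m J = J *m q -> q != 0 -> row 0 q = delta_mx 0 0.
Proof.
move=> qq qJ q0.
have [w [w0 wJ wq]] : exists w : 'rV_s.+1, [/\ w != 0, w *m J = 0 & w *m q = w].
  have [i ui] : exists i, row i q != 0.
    apply/existsP; apply: contraNT q0; rewrite negb_exists => /forallP z.
    by apply/eqP/row_matrixP => i; rewrite row0; apply/eqP; move: (z i); rewrite negbK.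
  set u := row i q in ui.
  have ex : exists t, u *m J ^+ t == 0 by exists s.+1; rewrite shift_mx_nilpotent // mulmx0.
  case: (ex_minnP ex) => -[|t]; first by rewrite expr0 mulmx1 (negPf ui).
  have qJt l : q *m J ^+ l = J ^+ l *m q.
    elim: l => [|l IHl]; first by rewrite expr0 mulmx1 mul1mx.
    by rewrite exprSr mulmxA IHl -!mulmxA qJ.
  move=> /eqP ut mint; exists (u *m J ^+ t); split.
  - by apply/negP => /mint; rewrite ltnn.
  - by rewrite -ut exprSr mulmxA.
  - by rewrite -mulmxA -qJt mulmxA -row_mul qq.
have ws j : j != 0 -> w 0 j = 0.
  case: j => -[//|j] ltj _; have ltj' := ltnW ltj.
  have := congr1 (fun X : 'rV_s.+1 => X 0 (Ordinal ltj')) wJ.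
  rewrite !mxE (bigD1 (Ordinal ltj)) //= big1 => [|l ne].
    by rewrite addr0 mxE eqxx mulr1.
  rewrite mxE (_ : (l == _ :> nat) = false) ?mulr0 //.
  by apply: contraNF ne => /eqP e; apply/eqP/val_inj.
have wE : w = w 0 0 *: delta_mx 0 0.
  apply/rowP => j; rewrite !mxE eqxx /=.
  by have [->|ne] := eqVneq j 0; rewrite ?mulr1 // mulr0 ws.
have w00 : w 0 0 != 0 by apply: contraNneq w0 => e; rewrite wE e scale0r.
move: wq; rewrite wE -scalemxAl -rowE => /(congr1 ( *:%R (w 0 0)^-1)).
by rewrite !scalerA mulVf // !scale1r.
Qed.

Lemma shift_commuting_idempotent s (p : 'M[k]_s.+1) (J := shift_mx k s.+1) :
  p *m p = p -> p *m J = J *m p -> p = 0 \/ p = 1%:M.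
Proof.
move=> pp pJ; have [->|p0] := eqVneq p 0; first by left.
right; apply/eqP; rewrite eq_sym -subr_eq0; apply: contraTT isT => p1.
have e0 := shift_commuting_fix pp pJ p0.
have : row 0 (1%:M - p) = delta_mx 0 0.
  apply: shift_commuting_fix p1.
    by rewrite mulmxBr mulmx1 mulmxBl mul1mx pp subrr subr0.
  by rewrite mulmxBl mulmxBr mulmx1 mul1mx pJ.
rewrite linearB /= e0 row1 subrr => /(congr1 (fun X : 'rV_s.+1 => X 0 0)).
by rewrite !mxE => /eqP; rewrite eq_sym oner_eq0.
Qed.

Lemma endo_rep23 I (d2 d3 : nat) (B : 'M[k]_d2) (C : 'M[k]_(d2, d3)) (V := rep23 B C)
    (F : 'M[k]_(d2 + d3)) : is_mod I V -> is_hom (V := V) (W := V) F ->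
  exists F2 F3, [/\ F = block_mx F2 0 0 F3, F2 *m B = B *m F2 & F2 *m C = C *m F3].
Proof.
rewrite /V => hV; have [[[[[ge1 ge2] ge3] ga] gb] gc] := rep23_gens B C.
rewrite -[F]submxK; move: (ulsubmx _) (ursubmx _) (dlsubmx _) (drsubmx _) => P Q R S.
rewrite /block_mx => /(hom_to_rep23 _ _ hV hV).
rewrite ge2 ge3 gb gc !mul_row_block !(mulmx0, mul0mx, mulmx1, addr0, add0r) !mul_mx_row.
move=> [/eq_row_mx[_ Q0] /eq_row_mx[R0 _] /eq_row_mx[PB _] /eq_row_mx[_ PC]].
by exists P, S; split; rewrite ?Q0 ?R0 //.
Qed.

Section Member.
Variable m : nat.
Let s := m.+1.
Let J : 'M[k]_s := shift_mx k s.
Let N : 'M[k]_(s + s) := block_mx 0 0 1%:M 0.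
Let D : 'M[k]_(s + s) := block_mx 0 1%:M 0 0.
Let K : 'M[k]_(s + s) := block_mx 0 0 0 J.

(* [(x0, x1, x2, x3) |-> (0, x0, x1, x2)], respectively [(e, f) |-> (e, f, 0, J f)]. *)
Definition family_loop : 'M[k]_((s + s) + (s + s)) := block_mx N 0 D N.
Definition family_arrow : 'M[k]_((s + s) + (s + s), s + s) := col_mx 1%:M K.
Definition family_rep : rep k := rep23 family_loop family_arrow.

Let block_simp := (mulmx_block, mul_block_col, mul0mx, mulmx0, mul1mx, mulmx1, addr0, add0r).

Lemma family_loop2 : family_loop *m family_loop = block_mx 0 0 1%:M 0.
Proof.
rewrite /family_loop ?block_simp /N /D ?block_simp add_block_mx ?block_simp.
by rewrite -scalar_mx_block block_mx_const.
Qed.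

Lemma family_loop4 n : (4 <= n)%N -> family_loop ^+ n = 0.
Proof.
move=> n4; rewrite -(subnK n4) exprD (exprD _ 2 2) expr2 -[_ * family_loop]/(_ *m _).
by rewrite family_loop2 -[_ * block_mx _ _ _ _ in X in _ * X]/(_ *m _) ?block_simp
  block_mx_const mulr0.
Qed.

Lemma family_endo I (F : 'M[k]_(rdim family_rep)) : is_mod I family_rep ->
  is_hom (V := family_rep) (W := family_rep) F -> exists p : 'M[k]_s, p *m J = J *m p /\
    F = block_mx (block_mx (block_mx p 0 0 p) 0 0 (block_mx p 0 0 p)) 0 0 (block_mx p 0 0 p).
Proof.
move=> hV /(endo_rep23 hV)[F2 [F3 [-> FB FC]]].
have FBB : F2 *m (family_loop *m family_loop) = (family_loop *m family_loop) *m F2.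
  by rewrite mulmxA FB -mulmxA FB mulmxA.
move: FBB FB FC; rewrite family_loop2 /family_loop /family_arrow.
rewrite -[F2]submxK; move: (ulsubmx _) (ursubmx _) (dlsubmx _) (drsubmx _) => P Q R S.
rewrite ?block_simp => /eq_block_mx[Q0 _ SP _]; subst Q S.
rewrite ?block_simp => /eq_block_mx[PN _ RN _].
rewrite mul_col_mx mul1mx => /eq_col_mx[PF RK]; subst F3.
have {}RK : R = K *m P - P *m K by rewrite -RK addrK.
move: PN RN RK; rewrite -[P]submxK /N /K /D.
move: (ulsubmx P) (ursubmx P) (dlsubmx P) (drsubmx P) => {P} p q r t.
rewrite ?block_simp => /eq_block_mx[q0 _ tp _]; subst q t.
rewrite ?block_simp opp_block_mx add_block_mx ?oppr0 ?addr0 => + eR; subst R.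
rewrite ?block_simp !add_block_mx ?block_simp => /eq_block_mx[r0 _ Jp _]; subst r.
exists p; split; first by apply/esym/eqP; rewrite -subr_eq0 Jp.
by rewrite mulmx0 Jp !block_mx_const.
Qed.

Lemma family_indecomposable I : is_mod I family_rep -> indecomposable I family_rep.
Proof.
move=> hV; split=> //; split=> // V1 V2 _ _ [F [G [hF [hG [GF FG]]]]].
pose e : 'M[k]_(rdim V1 + rdim V2) := block_mx 1%:M 0 0 0.
pose pi := G *m e *m F.
have ee : e *m e = e by rewrite /e ?block_simp.
have hpi : is_hom (V := family_rep) (W := family_rep) pi.
  move=> M kM; rewrite /pi -mulmxA hF // !mulmxA -hG //; congr (_ *m _).
  by rewrite -!mulmxA; congr (_ *m _); rewrite /e /= !block_simp.
have pi2 : pi *m pi = pi.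
  by rewrite /pi -!mulmxA (mulmxA F) FG mul1mx (mulmxA e) ee.
have epi : e = F *m pi *m G by rewrite /pi !mulmxA FG mul1mx -mulmxA FG mulmx1.
have mx1_0 d : (1%:M : 'M[k]_d) = 0 -> d = 0%N.
  by move=> e10; rewrite -(mxrank1 k d) e10 mxrank0.
have [p [pJ ep]] := family_endo hV hpi.
have pp : p *m p = p.
  move: pi2; rewrite ep ?block_simp => /eq_block_mx[/eq_block_mx[/eq_block_mx[//]]].
case: (shift_commuting_idempotent pp pJ) => p01; rewrite {}p01 in ep.
  left; apply: mx1_0; move: epi; rewrite ep !block_mx_const mulmx0 mul0mx.
  by rewrite /e -[RHS](block_mx_const _ _ _ _ 0) => /eq_block_mx[].
right; apply: mx1_0; move: epi; rewrite ep -!scalar_mx_block mulmx1 FG.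
by rewrite /e scalar_mx_block => /eq_block_mx[].
Qed.

End Member.

Lemma iso_rdim (V W : rep k) : iso V W -> rdim V = rdim W.
Proof.
case=> F [G [_ [_ [/mulmx1_rank rG /mulmx1_rank rF]]]].
by have := rank_leq_col G; have := rank_leq_col F; lia.
Qed.

Lemma HH1_vanishes_infinite_rep_type (I : Mx k -> Prop) :
  admissible I -> HH1_vanishes I -> infinite_rep_type I.
Proof.
move=> adm hHH; have [a [b [n hexp]]] := admissible_exponents adm.
have hI := adm.1; have n4 := HH1_vanishes_ge4 hI hexp hHH.
have [_ eb] := HH1_vanishes_full_exponents hI hexp hHH.
exists family_rep; split=> [m | m m' ne /iso_rdim /=]; last by lia.
apply: family_indecomposable; apply: (rep23_is_mod hI hexp); rewrite family_loop4 ?eb //.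
exact: mul0mx.
Qed.

End Family.

Theorem mainTheorem1 (k : fieldType) :
  (exists I : Mx k -> Prop, admissible I /\ HH1_vanishes I) /\
  (forall I : Mx k -> Prop, admissible I -> infinite_gldim I) /\
  (forall I : Mx k -> Prop, admissible I -> HH1_vanishes I -> infinite_rep_type I).
Proof.
split; first by exists (@rigid_ideal k); split;
  [exact: rigid_ideal_admissible | exact: rigid_ideal_HH1].
split=> I adm; last exact: HH1_vanishes_infinite_rep_type.
have [a [b [n hexp]]] := admissible_exponents adm.
exact: infinite_gldim_exponents adm.1 hexp.
Qed.
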